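(* Let $\tilde G\colon[0,\infty)\to(0,\infty)$ be continuous and strictly increasing with $\lim_{r\to\infty}\tilde G(r)=\infty$. Then there exist an entire function $\varphi$ and $R_0>0$ such that $$\log\log M(r,\varphi)<\tilde G(r)\log r\qquad\text{for all } r>R_0,$$ and such that every $w\in\overline{\mathbb C}=\mathbb C\cup\{\infty\}$ is an asymptotic value of $\varphi$.
   Context: For an entire function $f$, $M(r,f)=\max\{|f(z)|:|z|=r\}$. A point $w\in\overline{\mathbb C}$ is an asymptotic value of $f$ if there is a path $\gamma$ from $0$ to $\infty$ such that $f(z)\to w$ as $z\to\infty$ along $\gamma$. *)

(* Defs.v *)
From Stdlib Require Import Reals.
From Coquelicot Require Import Coquelicot.
Open Scope R_scope.

Definition entire (f : C -> C) : Prop :=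
  forall z : C, @ex_derive C_AbsRing C_NormedModule f z.

(* M(r,f) = max { |f z| : |z| = r } (written as the supremum, which is attained). *)
Definition maxmod (r : R) (f : C -> C) : R :=
  real (Lub_Rbar (fun y => exists z : C, Cmod z = r /\ y = Cmod (f z))).

Definition path_to_infty (gamma : R -> C) : Prop :=
  (forall t : R, 0 <= t ->
     filterlim gamma (within (fun s => 0 <= s) (locally t)) (locally (gamma t))) /\ gamma 0 = 0%C /\
  filterlim (fun t => Cmod (gamma t)) (Rbar_locally p_infty) (Rbar_locally p_infty).

(* Points of the Riemann sphere: Some w = finite w, None = infinity. *)
Definition sphere := option C.

Definition asymptotic_value (f : C -> C) (w : sphere) : Prop :=
  exists gamma : R -> C, path_to_infty gamma /\
    match w with
    | Some a => filterlim (fun t => f (gamma t)) (Rbar_locally p_infty) (locally a)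
    | None => filterlim (fun t => Cmod (f (gamma t))) (Rbar_locally p_infty) (Rbar_locally p_infty)
    end.

(* Main.v *)
(** Let [gauss z] be the integral of [exp (- s ^ 2)] from [0] to [z].  It tends to a constant [c > 0] in the sector [|Im z| <= Re z / 2], to [-c] in the opposite one, and is bounded on both.  Put [phi z = sum_j weight j * gauss ((z / rho j) ^ (16 ^ j))], where [weight j] is [1 / (j + 1)] for even [j], [i / (j + 1)] for odd [j], and [rho] grows so fast that on a given circle at most two terms are neither negligible nor close to their limits.  On a ray whose angle divided by [2 PI] has only the digits 0 and 8 in base 16, the argument of the [j]-th term stays in one of the two sectors, the one selected by the [j]-th digit.  Along it [phi] therefore follows the partial sums of [c * sum_j +- weight j], whose signs can be chosen freely; both [sum_(j even) 1 / (j + 1)] and [sum_(j odd) 1 / (j + 1)] diverge with terms tending to 0, so every complex number and infinity are attained as limits.  For [rho N <= |z| <= rho (N + 1)] one has [ln ln |phi z| <= 3 * 16 ^ N * ln |z|], which is below [G |z| * ln |z|] once [rho N] is large enough. *)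

Require Import Defs.
From Stdlib Require Import Reals Factorial IndefiniteDescription Lra Lia.
From Coquelicot Require Import Coquelicot.
Open Scope R_scope.

(** * Complex derivatives *)

(** The target carries the structure [AbsRing_NormedModule C_AbsRing], for which the product and
    chain rules are stated; [cderiv_ex_derive] transfers the result to the structure used in
    [entire]. *)
Definition cderiv (f : C -> C) (z l : C) : Prop :=
  @is_derive C_AbsRing (AbsRing_NormedModule C_AbsRing) f z l.

Lemma cderivP (f : C -> C) (z l : C) :
  cderiv f z l <->
  forall eps, 0 < eps -> exists del, 0 < del /\
    forall h, Cmod h < del ->
      Cmod (f (z + h) - f z - h * l)%C <= eps * Cmod h.
Proof.
split.
- intros [_ H] eps Heps.
  destruct (H z (fun P HP => HP) (mkposreal eps Heps)) as [d Hd].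
  exists d; split; [apply cond_pos|]. intros h Hh.
  assert (Hb : Cmod (Cminus (z + h) z) < d)
    by (replace (z + h - z)%C with h by ring; exact Hh).
  assert (Hn := Hd (z + h)%C Hb).
  change (Cmod (f (z + h) - f z - (z + h - z) * l)%C <= eps * Cmod (z + h - z)%C) in Hn.
  now replace (z + h - z)%C with h in Hn by ring.
- intros H. split; [apply is_linear_scal_l|].
  intros x Hx.
  apply (is_filter_lim_locally_unique (K:=C_AbsRing) (V:=AbsRing_NormedModule C_AbsRing)) in Hx. subst x.
  intros [eps Heps]. destruct (H eps Heps) as [d [Hd H']].
  exists (mkposreal d Hd). intros y Hy.
  change (Cmod (y - z)%C < d) in Hy.
  assert (Hn := H' _ Hy).
  assert (Hz : forall c : C, (z + (c - z))%C = c) by (intros; ring).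
  rewrite Hz in Hn. exact Hn.
Qed.

Lemma cderiv_ex_derive f z l :
  cderiv f z l -> @ex_derive C_AbsRing C_NormedModule f z.
Proof.
intros H. exists l. destruct H as [_ H].
split; [apply is_linear_scal_l|]. exact H.
Qed.

Lemma cderiv_const a z : cderiv (fun _ => a) z 0%C.
Proof. exact (@is_derive_const C_AbsRing (AbsRing_NormedModule C_AbsRing) a z). Qed.
Lemma cderiv_id z : cderiv (fun x => x) z 1%C.
Proof. exact (@is_derive_id C_AbsRing z). Qed.
Lemma cderiv_plus f g z l m :
  cderiv f z l -> cderiv g z m -> cderiv (fun x => f x + g x)%C z (l + m)%C.
Proof. exact (@is_derive_plus C_AbsRing (AbsRing_NormedModule C_AbsRing) f g z l m). Qed.
Lemma cderiv_mult f g z l m :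
  cderiv f z l -> cderiv g z m -> cderiv (fun x => f x * g x)%C z (l * g z + f z * m)%C.
Proof. intros Hf Hg. exact (@is_derive_mult C_AbsRing f g z l m Hf Hg Cmult_comm). Qed.
Lemma cderiv_comp f g z l m :
  cderiv g z m -> cderiv f (g z) l -> cderiv (fun x => f (g x)) z (m * l)%C.
Proof. intros H1 H2. exact (@is_derive_comp C_AbsRing (AbsRing_NormedModule C_AbsRing) f g z l m H2 H1). Qed.

Lemma cderiv_pow n z : cderiv (fun x => x ^ n)%C z (INR n * z ^ (pred n))%C.
Proof.
induction n as [|n IH].
- replace (INR 0 * z ^ pred 0)%C with (RtoC 0) by (simpl; ring). exact (cderiv_const 1%C z).
- assert (H := cderiv_mult _ _ _ _ _ (cderiv_id z) IH).
  replace (INR (S n) * z ^ pred (S n))%C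
    with (1 * z ^ n + z * (INR n * z ^ pred n))%C; [exact H|].
  rewrite S_INR, RtoC_plus. destruct n; simpl; ring.
Qed.

Lemma cderiv_scal a f z l : cderiv f z l -> cderiv (fun x => a * f x)%C z (a * l)%C.
Proof.
intros H. assert (H' := cderiv_mult _ _ _ _ _ (cderiv_const a z) H).
replace (a * l)%C with (0 * f z + a * l)%C by ring. exact H'.
Qed.

Lemma re_mult_conj_le v a : Re (Cconj v * a) <= Cmod v * Cmod a.
Proof.
rewrite <- (Cmod_conj v), <- Cmod_mult.
eapply Rle_trans; [apply Rle_abs|apply re_le_Cmod].
Qed.

Lemma re_mult_conj_self v : Re (Cconj v * v) = Cmod v * Cmod v.
Proof.
replace (Cmod v * Cmod v) with (Cmod v ^ 2) by ring.
rewrite Cmod2_alt, re_mult, re_conj, im_conj. ring.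
Qed.

(* Pairing with the conjugate of [f b - f a] reduces the inequality to the real mean value theorem. *)
Lemma mean_value f df a h K :
  (forall t, 0 <= t <= 1 -> cderiv f (a + t * h)%C (df (a + t * h)%C)) ->
  (forall t, 0 <= t <= 1 -> Cmod (df (a + t * h)%C) <= K) ->
  Cmod (f (a + h) - f a)%C <= K * Cmod h.
Proof.
intros Hd HK.
set (v := (f (a + h) - f a)%C).
set (u := fun t : R => Re (Cconj v * f (a + t * h)%C)).
set (du := fun t : R => Re (Cconj v * (h * df (a + t * h)%C))).
assert (Hu : forall t, 0 <= t <= 1 -> derivable_pt_lim u t (du t)).
{ intros t Ht eps Heps.
  (* The summand 1 keeps the denominator positive when [v] or [h] vanishes. *)
  assert (Hc : 0 < Cmod v * Cmod h + 1)
    by (generalize (Rmult_le_pos _ _ (Cmod_ge_0 v) (Cmod_ge_0 h)); lra).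
  destruct (proj1 (cderivP _ _ _) (Hd t Ht) (eps / (Cmod v * Cmod h + 1)))
    as [d [Hd0 Hd1]]; [now apply Rdiv_lt_0_compat|].
  assert (Hc' : 0 < Cmod h + 1) by (generalize (Cmod_ge_0 h); lra).
  exists (mkposreal _ (Rdiv_lt_0_compat _ _ Hd0 Hc')). intros s Hs Hsd. simpl in Hsd.
  assert (Hs0 : 0 < Rabs s) by now apply Rabs_pos_lt.
  assert (Hsh : Cmod (s * h)%C < d).
  { rewrite Cmod_mult, Cmod_R.
    apply Rlt_le_trans with (d / (Cmod h + 1) * (Cmod h + 1)); [|right; field; lra].
    apply Rle_lt_trans with (Rabs s * (Cmod h + 1)).
    - apply Rmult_le_compat_l; lra.
    - now apply Rmult_lt_compat_r. }
  specialize (Hd1 _ Hsh).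
  replace (a + t * h + s * h)%C with (a + (t + s)%R * h)%C in Hd1
    by (rewrite RtoC_plus; ring).
  set (q := (_ - _ - _)%C) in Hd1.
  assert (Hq : u (t + s) - u t - s * du t = Re (Cconj v * q)).
  { unfold u, du, q. rewrite <- re_scal_l. unfold Rminus. rewrite <- !re_opp, <- !re_plus.
    f_equal. ring. }
  replace ((u (t + s) - u t) / s - du t) with ((u (t + s) - u t - s * du t) / s)
    by (field; auto).
  rewrite Hq. unfold Rdiv. rewrite Rabs_mult, Rabs_inv.
  apply Rmult_lt_reg_r with (Rabs s); [auto|].
  rewrite Rmult_assoc, Rinv_l, Rmult_1_r by lra.
  apply Rle_lt_trans with (Cmod v * Cmod q).
  { rewrite <- (Cmod_conj v), <- Cmod_mult. apply re_le_Cmod. }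
  apply Rle_lt_trans with (Cmod v * (eps / (Cmod v * Cmod h + 1) * Cmod (s * h)%C)).
  { apply Rmult_le_compat_l; [apply Cmod_ge_0|auto]. }
  rewrite Cmod_mult, Cmod_R.
  replace (_ * _) with (eps * Rabs s * ((Cmod v * Cmod h) / (Cmod v * Cmod h + 1)))
    by (field; lra).
  rewrite <- (Rmult_1_r (eps * Rabs s)) at 2.
  apply Rmult_lt_compat_l; [now apply Rmult_lt_0_compat|].
  apply Rmult_lt_reg_r with (Cmod v * Cmod h + 1); [auto|].
  unfold Rdiv. rewrite Rmult_assoc, Rinv_l; lra. }
assert (HM : exists c, u 1 - u 0 = du c * (1 - 0) /\ 0 <= c <= 1).
{ destruct (MVT_gen u 0 1 du) as [c [Hc1 Hc2]].
  - intros x. rewrite Rmin_left, Rmax_right by lra. intros Hx.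
    apply is_derive_Reals, Hu; lra.
  - intros x. rewrite Rmin_left, Rmax_right by lra. intros Hx.
    apply derivable_continuous_pt. exists (du x). apply Hu, Hx.
  - rewrite Rmin_left, Rmax_right in Hc1 by lra. now exists c. }
destruct HM as [c [Hc1 Hc2]].
assert (E : Cmod v * Cmod v = du c).
{ rewrite <- re_mult_conj_self. transitivity (u 1 - u 0); [|rewrite Hc1; ring].
  unfold u, Rminus. rewrite <- re_opp, <- re_plus. f_equal.
  unfold v at 2. replace (a + 1 * h)%C with (a + h)%C by ring.
  replace (a + 0 * h)%C with a by ring. ring. }
assert (F : du c <= Cmod v * (K * Cmod h)).
{ unfold du. eapply Rle_trans; [apply re_mult_conj_le|].
  apply Rmult_le_compat_l; [apply Cmod_ge_0|]. rewrite Cmod_mult, Rmult_comm.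
  apply Rmult_le_compat_r; [apply Cmod_ge_0|now apply HK]. }
rewrite <- E in F.
destruct (Rle_lt_or_eq_dec _ _ (Cmod_ge_0 v)) as [Hv|Hv].
- now apply Rmult_le_reg_l with (Cmod v).
- rewrite <- Hv. apply Rmult_le_pos; [|apply Cmod_ge_0].
  eapply Rle_trans; [apply Cmod_ge_0|apply (HK 0); lra].
Qed.

(** * Series of complex functions *)

(** Summation by components reuses the real [Series]. Since that function is total, the algebraic
    rules below carry [dominated] as a witness of absolute convergence. *)
Definition csum (a : nat -> C) : C :=
  (Series (fun n => Re (a n)), Series (fun n => Im (a n))).

Fixpoint psum (a : nat -> C) (n : nat) : C :=
  match n with O => 0%C | S n => (psum a n + a n)%C end.

Definition dominated (a : nat -> C) (b : nat -> R) : Prop :=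
  ex_series b /\ forall n, Cmod (a n) <= b n.

Lemma im_le_Cmod z : Rabs (Im z) <= Cmod z.
Proof. eapply Rle_trans; [apply Rmax_r|apply Rmax_Cmod]. Qed.

Lemma ex_series_Rabs_le (a b : nat -> R) :
  ex_series b -> (forall n, Rabs (a n) <= b n) -> ex_series a.
Proof.
intros Hb Hab.
exact (@ex_series_le R_AbsRing R_CompleteNormedModule a b Hab Hb).
Qed.

Lemma ex_series_Rmult_l (c : R) (a : nat -> R) :
  ex_series a -> ex_series (fun n => c * a n).
Proof. exact (@ex_series_scal R_AbsRing R_NormedModule c a). Qed.

Lemma dominated_re a b : dominated a b -> ex_series (fun n => Re (a n)).
Proof.
intros [Hb Hab]. apply ex_series_Rabs_le with (1 := Hb). intros n.
eapply Rle_trans; [apply re_le_Cmod|apply Hab].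
Qed.

Lemma dominated_im a b : dominated a b -> ex_series (fun n => Im (a n)).
Proof.
intros [Hb Hab]. apply ex_series_Rabs_le with (1 := Hb). intros n.
eapply Rle_trans; [apply im_le_Cmod|apply Hab].
Qed.

Lemma csum_ext a b : (forall n, a n = b n) -> csum a = csum b.
Proof.
intros H. unfold csum. f_equal; apply Series_ext; intros n; now rewrite H.
Qed.

Lemma csum_plus a b ba bb : dominated a ba -> dominated b bb ->
  csum (fun n => a n + b n)%C = (csum a + csum b)%C.
Proof.
intros Ha Hb. apply injective_projections; simpl.
- rewrite <- Series_plus; [|eapply dominated_re; eauto..].
  apply Series_ext. intros n. apply re_plus.
- rewrite <- Series_plus; [|eapply dominated_im; eauto..].
  apply Series_ext. intros n. apply im_plus.
Qed.

Lemma csum_scal c a b : dominated a b ->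
  csum (fun n => c * a n)%C = (c * csum a)%C.
Proof.
intros H.
assert (Hr := dominated_re _ _ H). assert (Hi := dominated_im _ _ H).
apply injective_projections; simpl; rewrite <- !Series_scal_l.
- rewrite <- Series_minus; [|now apply ex_series_Rmult_l..].
  apply Series_ext. intros n. apply re_mult.
- rewrite <- Series_plus; [|now apply ex_series_Rmult_l..].
  apply Series_ext. intros n. apply im_mult.
Qed.

Lemma dominated_plus a b ba bb : dominated a ba -> dominated b bb ->
  dominated (fun n => a n + b n)%C (fun n => ba n + bb n).
Proof.
intros [Ha Ha'] [Hb Hb']. split.
- exact (@ex_series_plus R_AbsRing R_NormedModule ba bb Ha Hb).
- intros n. eapply Rle_trans; [apply Cmod_triangle|]. now apply Rplus_le_compat.
Qed.

Lemma dominated_scal c a b : dominated a b ->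
  dominated (fun n => c * a n)%C (fun n => Cmod c * b n).
Proof.
intros [Ha Ha']. split.
- now apply ex_series_Rmult_l.
- intros n. rewrite Cmod_mult. apply Rmult_le_compat_l; auto. apply Cmod_ge_0.
Qed.

(* Pairing with the conjugate of [csum a] reduces this to the triangle inequality for a real series. *)
Lemma csum_le a b : dominated a b -> Cmod (csum a) <= Series b.
Proof.
intros H. set (v := csum a).
assert (E : Cmod v * Cmod v <= Cmod v * Series b).
{ rewrite <- re_mult_conj_self. unfold v at 2. rewrite <- (csum_scal _ _ b) by auto.
  change (Re (csum (fun n => Cconj v * a n)%C))
    with (Series (fun n => Re (Cconj v * a n)%C)).
  rewrite <- Series_scal_l.
  assert (Hd := dominated_scal (Cconj v) _ _ H). rewrite Cmod_conj in Hd.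
  eapply Rle_trans; [apply Rle_abs|].
  eapply Rle_trans; [apply Series_Rabs|apply Series_le]; try apply Hd.
  - apply ex_series_Rabs_le with (1 := proj1 Hd).
    intros n. rewrite Rabs_Rabsolu.
    eapply Rle_trans; [apply re_le_Cmod|apply Hd].
  - intros n. split; [apply Rabs_pos|].
    eapply Rle_trans; [apply re_le_Cmod|apply Hd]. }
destruct (Rle_lt_or_eq_dec _ _ (Cmod_ge_0 v)) as [Hv|Hv].
- now apply Rmult_le_reg_l with (Cmod v).
- rewrite <- Hv. rewrite <- (Rmult_0_l (Series (fun _ => 0))), <- Series_scal_l.
  apply Series_le; [|apply H]. intros n. rewrite Rmult_0_l. split; [lra|].
  eapply Rle_trans; [apply Cmod_ge_0|apply H].
Qed.


Lemma csum_shift a J :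
  ex_series (fun n => Re (a (J + n)%nat)) -> ex_series (fun n => Im (a (J + n)%nat)) ->
  csum a = (psum a J + csum (fun n => a (J + n)%nat))%C.
Proof.
induction J as [|J IH]; intros Hr Hi.
- simpl. symmetry. apply Cplus_0_l.
- assert (Hr' : ex_series (fun n => Re (a (J + n)%nat))).
  { apply ex_series_incr_1. revert Hr. apply ex_series_ext. intros n.
    now rewrite <- plus_n_Sm. }
  assert (Hi' : ex_series (fun n => Im (a (J + n)%nat))).
  { apply ex_series_incr_1. revert Hi. apply ex_series_ext. intros n.
    now rewrite <- plus_n_Sm. }
  rewrite (IH Hr' Hi'). simpl psum. rewrite <- Cplus_assoc. f_equal.
  unfold csum at 1. rewrite (Series_incr_1 _ Hr'), (Series_incr_1 _ Hi').
  rewrite <- plus_n_O. unfold csum, Cplus. simpl. f_equal; f_equal; apply Series_ext;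
  intros n; now rewrite <- plus_n_Sm.
Qed.

(** The domination starts at index [J], so the leading terms, which are large in the lacunary sum,
    do not enter the bound. *)
Lemma csum_tail a b J : dominated (fun n => a (J + n)%nat) b ->
  Cmod (csum a - psum a J)%C <= Series b.
Proof.
intros H. rewrite (csum_shift a J); [|eapply dominated_re|eapply dominated_im]; eauto.
set (c := csum (fun n => a (J + n)%nat)).
replace (psum a J + c - psum a J)%C with c by ring.
now apply csum_le.
Qed.

Lemma psum_le a K n : (forall j, (j < n)%nat -> Cmod (a j) <= K) ->
  Cmod (psum a n) <= INR n * K.
Proof.
induction n as [|n IH]; intros H.
- simpl. rewrite Cmod_0. lra.
- rewrite S_INR. simpl psum. eapply Rle_trans; [apply Cmod_triangle|].
  assert (Cmod (psum a n) <= INR n * K) by (apply IH; intros; apply H; lia).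
  assert (Cmod (a n) <= K) by (apply H; lia). lra.
Qed.

Lemma psum_ext a b n : (forall j, a j = b j) -> psum a n = psum b n.
Proof. intros H. induction n as [|n IH]; simpl; [reflexivity|now rewrite IH, H]. Qed.

Lemma psum_plus a b n :
  psum (fun j => a j + b j)%C n = (psum a n + psum b n)%C.
Proof. induction n as [|n IH]; simpl; [ring|rewrite IH; ring]. Qed.

Lemma psum_scal c a n : psum (fun j => c * a j)%C n = (c * psum a n)%C.
Proof. induction n as [|n IH]; simpl; [ring|rewrite IH; ring]. Qed.

Lemma cderiv_psum (g dg : nat -> C -> C) z n :
  (forall j, cderiv (g j) z (dg j z)) ->
  cderiv (fun x => psum (fun j => g j x) n) z (psum (fun j => dg j z) n).
Proof.
intros H. induction n as [|n IH]; simpl.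
- exact (cderiv_const 0%C z).
- exact (cderiv_plus _ _ _ _ _ IH (H n)).
Qed.

Lemma Series_tail_small b eps : ex_series b -> 0 < eps ->
  exists J : nat, Series (fun n => b (J + n)%nat) < eps.
Proof.
intros Hb Heps.
assert (Hs := Series_correct _ Hb).
destruct (proj1 (filterlim_locally (F:=eventually) (sum_n b) (Series b)) Hs
   (mkposreal _ Heps)) as [N HN].
(* [sum_n b N] includes the term of index [N], so the tail starts at [S N]. *)
exists (S N). assert (H := HN N (le_n N)).
rewrite (Series_incr_n b (S N)) in H by (auto; lia).
unfold ball in H; simpl in H; unfold AbsRing_ball, abs, minus, plus, opp in H; simpl in H.
rewrite sum_n_Reals in H. apply Rabs_lt_between in H. simpl. lra.
Qed.

(* Termwise differentiation: the remainder of the tail of the series is controlled by the mean value inequality. *)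
Lemma cderiv_csum (g dg : nat -> C -> C) (z : C) :
  (forall j (x : C), cderiv (g j) x (dg j x)) ->
  (forall r, 0 < r -> exists b : nat -> R, ex_series b /\
     forall j (x : C), Cmod x <= r -> Cmod (g j x) <= b j /\ Cmod (dg j x) <= b j) ->
  cderiv (fun x => csum (fun j => g j x)) z (csum (fun j => dg j z)).
Proof.
intros Hd Hb. apply cderivP. intros eps Heps.
assert (Hz := Cmod_ge_0 z).
(* With increments shorter than 1, the segment from [z] to [z + h] stays in this disc. The tail of
   the remainder is at most [2 * Cmod h] times the tail of [b], so [eps / 4] there leaves [eps / 2]
   for the finite part. *)
destruct (Hb (Cmod z + 1)) as [b [Hb1 Hb2]]; [lra|].
destruct (Series_tail_small b (eps / 4)) as [J HJ]; [auto|lra|].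
destruct (proj1 (cderivP _ _ _) (cderiv_psum g dg z J (fun j => Hd j z)) (eps / 2))
  as [d [Hd1 Hd2]]; [lra|].
exists (Rmin d 1). split; [apply Rmin_pos; lra|]. intros h Hh.
assert (Hh1 : Cmod h < d) by (eapply Rlt_le_trans; [exact Hh|apply Rmin_l]).
assert (Hh2 : Cmod h < 1) by (eapply Rlt_le_trans; [exact Hh|apply Rmin_r]).
specialize (Hd2 h Hh1). assert (Hh0 := Cmod_ge_0 h).
assert (D1 : dominated (fun j => g j (z + h)%C) b).
{ split; [auto|]. intros n. apply Hb2. generalize (Cmod_triangle z h); lra. }
assert (D2 : dominated (fun j => g j z) b) by (split; [auto|]; intros n; apply Hb2; lra).
assert (D3 : dominated (fun j => dg j z) b) by (split; [auto|]; intros n; apply Hb2; lra).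
(* The remainder of the [j]-th term, written with sums and scalings only so that [csum_plus] and
   [csum_scal] apply. *)
set (a := fun j => (g j (z + h) + (-(1) * g j z + - h * dg j z))%C).
assert (E : (csum (fun j => g j (z + h)) - csum (fun j => g j z)
   - h * csum (fun j => dg j z) = csum a)%C).
{ unfold a. rewrite (csum_plus _ _ b (fun j => Cmod (-(1))%C * b j + Cmod (-h)%C * b j)).
  - rewrite (csum_plus _ _ (fun j => Cmod (-(1))%C * b j) (fun j => Cmod (-h)%C * b j)).
    + rewrite !(csum_scal _ _ b) by auto. ring.
    + now apply dominated_scal.
    + now apply dominated_scal.
  - auto.
  - apply dominated_plus; now apply dominated_scal. }
assert (E' : (psum (fun j => g j (z + h)) J - psum (fun j => g j z) J
   - h * psum (fun j => dg j z) J = psum a J)%C).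
{ unfold a. rewrite !psum_plus, !psum_scal. ring. }
rewrite E. rewrite E' in Hd2.
assert (T : Cmod (csum a - psum a J)%C <= Series (fun n => 2 * Cmod h * b (J + n)%nat)).
{ apply csum_tail. split.
  - apply ex_series_Rmult_l. now apply ex_series_incr_n.
  - intros n. unfold a.
    replace (g (J + n)%nat (z + h) + (-(1) * g (J + n)%nat z + - h * dg (J + n)%nat z))%C
      with ((g (J + n)%nat (z + h) - g (J + n)%nat z) + - (h * dg (J + n)%nat z))%C by ring.
    eapply Rle_trans; [apply Cmod_triangle|]. rewrite Cmod_opp, Cmod_mult.
    assert (M : Cmod (g (J + n)%nat (z + h) - g (J + n)%nat z)%C <= b (J + n)%nat * Cmod h).
    { apply mean_value with (df := dg (J + n)%nat).
      - intros t Ht. apply Hd.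
      - intros t Ht. apply Hb2. eapply Rle_trans; [apply Cmod_triangle|].
        rewrite Cmod_mult, Cmod_R, Rabs_pos_eq by lra. nra. }
    assert (N : Cmod h * Cmod (dg (J + n)%nat z) <= Cmod h * b (J + n)%nat).
    { apply Rmult_le_compat_l; [auto|]. apply Hb2. lra. }
    lra. }
rewrite Series_scal_l in T.
replace (csum a) with (psum a J + (csum a - psum a J))%C by ring.
eapply Rle_trans; [apply Cmod_triangle|]. nra.
Qed.

(** * The complex exponential *)

Definition ifact (k : nat) : R := / INR (fact k).

Definition cexp (z : C) : C := csum (fun k => ifact k * z ^ k)%C.

Lemma ifact_pos k : 0 < ifact k.
Proof. apply Rinv_0_lt_compat, INR_fact_lt_0. Qed.

Lemma is_series_exp (r : R) : is_series (fun k => ifact k * r ^ k) (exp r).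
Proof.
apply is_series_ext with (2 := is_exp_Reals r). intros n.
rewrite pow_n_pow. apply Rmult_comm.
Qed.

Lemma Cmod_exp_term (z : C) k : Cmod (ifact k * z ^ k)%C = ifact k * Cmod z ^ k.
Proof.
rewrite Cmod_mult, Cmod_R, Cmod_pow, Rabs_pos_eq; auto. apply Rlt_le, ifact_pos.
Qed.

Lemma exp_term_S k (z : C) :
  (ifact (S k) * (INR (S k) * z ^ k) = ifact k * z ^ k)%C.
Proof.
rewrite Cmult_assoc, <- RtoC_mult. do 2 f_equal.
unfold ifact. rewrite fact_simpl, mult_INR. field.
split; [apply INR_fact_neq_0|now apply not_0_INR].
Qed.

Lemma cderiv_cexp z : cderiv cexp z (cexp z).
Proof.
set (dg := fun (k : nat) (z : C) => (ifact k * (INR k * z ^ pred k))%C).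
assert (H : cderiv cexp z (csum (fun k => dg k z))).
{ apply (cderiv_csum (fun k z => ifact k * z ^ k)%C dg).
  - intros j x. apply cderiv_scal, cderiv_pow.
  - intros r Hr.
    set (b := fun k => ifact k * r ^ k).
    (* The derivative of the [k]-th term is the term of index [k - 1], hence the shifted
       majorant. *)
    set (b' := fun k => match k with O => 0 | S n => b n end).
    exists (fun k => b k + b' k). split.
    + apply (ex_series_plus (V:=R_NormedModule) b b').
      * eexists; apply is_series_exp.
      * apply ex_series_incr_1. eexists; apply is_series_exp.
    + assert (Hb : forall k (x : C), Cmod x <= r ->
        Cmod (ifact k * x ^ k)%C <= b k).
      { intros k x Hx. rewrite Cmod_exp_term.
        apply Rmult_le_compat_l; [apply Rlt_le, ifact_pos|].
        apply pow_incr. split; [apply Cmod_ge_0|auto]. }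
      assert (Hb0 : forall k, 0 <= b k).
      { intros k. apply Rmult_le_pos; [apply Rlt_le, ifact_pos|].
        apply pow_le; lra. }
      intros j x Hx. assert (H1 := Hb j x Hx).
      split.
      * assert (0 <= b' j) by (destruct j; simpl; [lra|apply Hb0]). lra.
      * assert (Cmod (dg j x) <= b' j); [|generalize (Hb0 j); lra].
        unfold dg. destruct j as [|j].
        { simpl INR. rewrite Cmult_0_l, Cmult_0_r, Cmod_0. simpl. lra. }
        simpl pred. rewrite exp_term_S. now apply Hb. }
replace (cexp z) with (csum (fun k => dg k z)); [exact H|].
assert (E : forall n, dg (1 + n)%nat z = (ifact n * z ^ n)%C).
{ intros n. apply exp_term_S. }
assert (D : dominated (fun n => dg (1 + n)%nat z) (fun k => ifact k * Cmod z ^ k)).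
{ split; [eexists; apply is_series_exp|]. intros n. rewrite E, Cmod_exp_term.
  apply Rle_refl. }
rewrite (csum_shift _ 1); [|eapply dominated_re|eapply dominated_im]; eauto.
rewrite (csum_ext _ _ E). unfold dg. simpl. unfold cexp. ring.
Qed.

Lemma cexp_RtoC (x : R) : cexp x = exp x.
Proof.
apply injective_projections.
- change (Series (fun n => Re (ifact n * x ^ n)%C) = exp x).
  rewrite <- (is_series_unique _ _ (is_series_exp x)). apply Series_ext. intros n.
  rewrite <- RtoC_pow, <- RtoC_mult. apply re_RtoC.
- change (Series (fun n => Im (ifact n * x ^ n)%C) = 0).
  rewrite <- (Rmult_0_l (Series (fun _ => 0))), <- Series_scal_l. apply Series_ext. intros n.
  rewrite <- RtoC_pow, <- RtoC_mult, im_RtoC. ring.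
Qed.

Lemma cexp_conj z : cexp (Cconj z) = Cconj (cexp z).
Proof.
assert (E : forall n, (ifact n * Cconj z ^ n = Cconj (ifact n * z ^ n))%C).
{ intros n. rewrite Cmult_conj, Cpow_conj. f_equal.
  unfold Cconj, RtoC. simpl. now rewrite Ropp_0. }
unfold cexp. rewrite (csum_ext _ _ E). apply injective_projections; simpl.
- now apply Series_ext.
- rewrite <- Series_opp. now apply Series_ext.
Qed.

(* The function [x => cexp x * cexp (a - x)] has derivative 0. *)
Lemma cexp_plus z w : cexp (z + w) = (cexp z * cexp w)%C.
Proof.
assert (H := mean_value (fun x => cexp x * cexp (z + w - x))%C (fun _ => 0%C) 0 z 0).
(* The mean value bound with constant 0 compares the values at [z] and at 0, which are the two sides
   of the identity. *)
assert (H' : Cmod (cexp (0 + z) * cexp (z + w - (0 + z)) - cexp 0 * cexp (z + w - 0))%C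
   <= 0 * Cmod z).
{ apply H.
  - intros t Ht. set (x := (0 + t * z)%C).
    assert (K := cderiv_comp cexp (fun x => z + w + -(1) * x)%C x _ _
      (cderiv_plus _ _ _ _ _ (cderiv_const (z + w)%C x) (cderiv_scal (-(1))%C _ _ _ (cderiv_id x)))
      (cderiv_cexp _)).
    assert (K' := cderiv_mult _ _ _ _ _ (cderiv_cexp x) K). cbv beta in K'.
    assert (E : forall x, (z + w - x = z + w + - (1) * x)%C) by (intros; ring).
    apply (cderivP _ _ _). intros eps Heps.
    destruct (proj1 (cderivP _ _ _) K' eps Heps) as [d [Hd Hd']].
    exists d; split; auto. intros h Hh. rewrite !E.
    replace (h * 0)%C with (h * (cexp x * cexp (z + w + - (1) * x) +
       cexp x * ((0 + - (1) * 1) * cexp (z + w + - (1) * x))))%C by ring.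
    now apply Hd'.
  - intros. rewrite Cmod_0. lra. }
rewrite Rmult_0_l in H'.
replace (0 + z)%C with z in H' by ring. replace (z + w - z)%C with w in H' by ring.
replace (z + w - 0)%C with (z + w)%C in H' by ring.
rewrite (cexp_RtoC 0), exp_0, Cmult_1_l in H'.
assert (Z : Cmod (cexp z * cexp w - cexp (z + w))%C = 0)
  by (apply Rle_antisym; [auto|apply Cmod_ge_0]).
apply Cmod_eq_0 in Z. now apply Ceq_minus in Z.
Qed.

(** The square of the modulus is [cexp z * cexp (Cconj z)], which equals [cexp (z + Cconj z)], the
    exponential of [2 * Re z]. *)
Lemma Cmod_cexp z : Cmod (cexp z) = exp (Re z).
Proof.
apply Rsqr_inj; [apply Cmod_ge_0|apply Rlt_le, exp_pos|].
apply RtoC_inj. unfold Rsqr.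
replace (Cmod (cexp z) * Cmod (cexp z)) with (Cmod (cexp z) ^ 2) by ring.
rewrite Cmod2_conj, <- cexp_conj, <- cexp_plus, <- exp_plus, <- cexp_RtoC.
f_equal. unfold Cconj, RtoC, Cplus, Re. destruct z as [x y]. simpl. f_equal. ring.
Qed.

(** * The Gauss error integral *)

(** Integrating the power series of [exp (- s ^ 2)] term by term gives these coefficients, so no
    complex integral has to be defined. *)
Definition gcoef (k : nat) : R := (-1) ^ k * ifact k * / INR (2 * k + 1).

Definition gauss (z : C) : C := csum (fun k => gcoef k * z ^ (2 * k + 1))%C.

Lemma INR_odd_pos k : 1 <= INR (2 * k + 1).
Proof. apply (le_INR 1). lia. Qed.

Lemma gcoef_le k : Rabs (gcoef k) <= ifact k.
Proof.
unfold gcoef. rewrite !Rabs_mult, pow_1_abs, Rmult_1_l.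
assert (H := ifact_pos k). assert (H' := INR_odd_pos k).
rewrite (Rabs_pos_eq (ifact k)), Rabs_pos_eq; try lra.
- rewrite <- (Rmult_1_r (ifact k)) at 2. apply Rmult_le_compat_l; [lra|].
  rewrite <- Rinv_1. apply Rinv_le_contravar; lra.
- apply Rlt_le, Rinv_0_lt_compat. lra.
Qed.

Lemma Cmod_gauss_term (z : C) k :
  Cmod (gcoef k * z ^ (2 * k + 1))%C <= Cmod z * (ifact k * (Cmod z ^ 2) ^ k).
Proof.
rewrite Cmod_mult, Cmod_R, Cmod_pow, pow_add, pow_mult, pow_1.
assert (H := gcoef_le k).
assert (0 <= (Cmod z ^ 2) ^ k * Cmod z).
{ apply Rmult_le_pos; [apply pow_le, pow_le|]; apply Cmod_ge_0. }
replace (Cmod z * _) with (ifact k * ((Cmod z ^ 2) ^ k * Cmod z)) by ring.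
now apply Rmult_le_compat_r.
Qed.

Lemma Cmod_gauss_le z : Cmod (gauss z) <= Cmod z * exp (Cmod z ^ 2).
Proof.
rewrite <- (is_series_unique _ _ (is_series_exp (Cmod z ^ 2))), <- Series_scal_l.
apply csum_le. split; [|apply Cmod_gauss_term].
apply ex_series_Rmult_l. eexists; apply is_series_exp.
Qed.

Lemma dominated_gauss z :
  dominated (fun k => gcoef k * z ^ (2 * k + 1))%C
    (fun k => Cmod z * (ifact k * (Cmod z ^ 2) ^ k)).
Proof.
split; [|apply Cmod_gauss_term].
apply ex_series_Rmult_l. eexists; apply is_series_exp.
Qed.

Lemma gauss_opp z : gauss (- z) = (- gauss z)%C.
Proof.
unfold gauss. transitivity (-(1) * csum (fun k => gcoef k * z ^ (2 * k + 1)))%C; [|ring].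
rewrite <- (csum_scal _ _ _ (dominated_gauss z)). apply csum_ext. intros k.
rewrite !Cpow_add_r, !Cpow_mult_r, !Cpow_1_r.
replace ((- z) ^ 2)%C with (z ^ 2)%C by ring. ring.
Qed.

Lemma cderiv_gauss z : cderiv gauss z (cexp (- z ^ 2)).
Proof.
apply (cderiv_csum (fun k z => gcoef k * z ^ (2 * k + 1))%C
  (fun k z => ifact k * (- z ^ 2) ^ k)%C).
- intros j x. assert (H := cderiv_scal (gcoef j) _ _ _ (cderiv_pow (2 * j + 1) x)).
  replace (ifact j * (- x ^ 2) ^ j)%C
    with (gcoef j * (INR (2 * j + 1) * x ^ pred (2 * j + 1)))%C; [exact H|].
  rewrite Nat.add_1_r at 2. simpl pred.
  replace (- x ^ 2)%C with ((-1)%R * x ^ 2)%C by (replace (RtoC (-1)) with (- (1))%C by (apply injective_projections; simpl; ring); ring).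
  rewrite Cpow_mult_l, <- RtoC_pow, <- Cpow_mult_r, !Cmult_assoc, <- !RtoC_mult.
  do 2 f_equal. unfold gcoef. field. generalize (INR_odd_pos j); lra.
(* In the factor [1 + r], the summand [r] serves the terms and 1 serves their derivatives. *)
- intros r Hr. exists (fun k => (1 + r) * (ifact k * (r ^ 2) ^ k)). split.
  + apply ex_series_Rmult_l. eexists; apply is_series_exp.
  + intros j x Hx.
    assert (H0 : 0 <= ifact j * (Cmod x ^ 2) ^ j <= ifact j * (r ^ 2) ^ j).
    { assert (H := ifact_pos j). assert (Hx0 := Cmod_ge_0 x). split.
      - apply Rmult_le_pos; [lra|]. now apply pow_le, pow_le.
      - apply Rmult_le_compat_l; [lra|]. apply pow_incr. split; [now apply pow_le|].
        now apply pow_incr. }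
    assert (Hx0 := Cmod_ge_0 x). split.
    * eapply Rle_trans; [apply Cmod_gauss_term|]. apply Rmult_le_compat; lra.
    * rewrite Cmod_exp_term, Cmod_opp, Cmod_pow. nra.
Qed.

(** * The error integral on the real axis and in a sector *)

Definition rgauss (x : R) : R := Re (gauss x).

Lemma gauss_RtoC (x : R) : gauss x = rgauss x.
Proof.
apply injective_projections; [reflexivity|].
change (Series (fun k => Im (gcoef k * x ^ (2 * k + 1))%C) = 0).
rewrite <- (Rmult_0_l (Series (fun _ => 0))), <- Series_scal_l. apply Series_ext. intros n.
rewrite <- RtoC_pow, <- RtoC_mult, im_RtoC. ring.
Qed.

Lemma rgauss_deriv x : derivable_pt_lim rgauss x (exp (- x ^ 2)).
Proof.
intros eps Heps.
destruct (proj1 (cderivP _ _ _) (cderiv_gauss x) (eps / 2)) as [d [Hd Hd']]; [lra|].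
exists (mkposreal d Hd). intros h Hh Hhd. simpl in Hhd.
assert (Hh0 : 0 < Rabs h) by now apply Rabs_pos_lt.
specialize (Hd' h). rewrite Cmod_R in Hd'. specialize (Hd' Hhd).
assert (E : (gauss (x + h) - gauss x - h * cexp (- x ^ 2))%C
   = rgauss (x + h) - rgauss x - h * exp (- x ^ 2)).
{ rewrite <- RtoC_plus, !gauss_RtoC, <- RtoC_pow, <- RtoC_opp, cexp_RtoC.
  now rewrite !RtoC_minus, RtoC_mult. }
rewrite E, Cmod_R in Hd'.
replace ((rgauss (x + h) - rgauss x) / h - exp (- x ^ 2))
  with ((rgauss (x + h) - rgauss x - h * exp (- x ^ 2)) / h) by (field; auto).
unfold Rdiv at 1. rewrite Rabs_mult, Rabs_inv.
apply Rmult_lt_reg_r with (Rabs h); [auto|].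
rewrite Rmult_assoc, Rinv_l, Rmult_1_r by lra. nra.
Qed.

Lemma rgauss_incr x y : x < y -> rgauss x < rgauss y.
Proof.
intros H. destruct (MVT_cor2 rgauss (fun s => exp (- s ^ 2)) x y H) as [c [Hc _]].
- intros; apply rgauss_deriv.
- assert (Hp := exp_pos (- c ^ 2)). nra.
Qed.

Lemma exp_neg_le u : 0 <= u -> exp (- u) * (1 + u) <= 1.
Proof.
intros Hu. replace 1 with (exp (- u) * exp u) at 2
  by (rewrite <- exp_plus, Rplus_opp_l; apply exp_0).
apply Rmult_le_compat_l; [apply Rlt_le, exp_pos|].
destruct Hu as [Hu|<-]; [apply Rlt_le, exp_ineq1; lra|rewrite exp_0; lra].
Qed.

(* [x |-> rgauss x + / x] is decreasing since [exp (- x ^ 2) <= / x ^ 2]. *)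
Lemma rgauss_tail x y : 1 <= x -> x <= y -> rgauss y <= rgauss x + / x.
Proof.
intros Hx [Hxy|<-]; [|assert (0 < / x) by (apply Rinv_0_lt_compat; lra); lra].
destruct (MVT_cor2 (fun s => rgauss s + / s) (fun s => exp (- s ^ 2) + - / s ^ 2) x y Hxy)
  as [c [Hc Hc']].
- intros c Hc. apply derivable_pt_lim_plus; [apply rgauss_deriv|].
  apply is_derive_Reals. auto_derive; [lra|field; lra].
- assert (Hp : exp (- c ^ 2) <= / c ^ 2).
  { assert (Hc2 : 0 < c ^ 2) by (apply pow_lt; lra).
    apply Rmult_le_reg_r with (c ^ 2); [auto|]. rewrite Rinv_l by lra.
    assert (H := exp_neg_le (c ^ 2)). assert (Hp := exp_pos (- c ^ 2)). nra. }
  assert (0 < / y) by (apply Rinv_0_lt_compat; lra). nra.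
Qed.

(** The limit is the supremum of the increasing function [rgauss] over [x >= 1]; [rgauss_tail]
    bounds what remains beyond [x]. *)
Lemma rgauss_lim : exists c, 0 < c /\ forall x, 1 <= x -> Rabs (rgauss x - c) <= / x.
Proof.
destruct (completeness (fun v => exists x, 1 <= x /\ v = rgauss x)) as [c [Hc1 Hc2]].
- exists (rgauss 1 + / 1). intros v [x [Hx ->]]. apply rgauss_tail; lra.
- exists (rgauss 1). exists 1. split; [lra|auto].
- exists c. split.
  + apply Rlt_le_trans with (rgauss 1); [|apply Hc1; exists 1; split; [lra|auto]].
    apply Rle_lt_trans with (rgauss 0); [|apply rgauss_incr; lra].
    assert (H := Cmod_gauss_le 0). rewrite Cmod_0, Rmult_0_l in H.
    assert (H' := re_le_Cmod (gauss 0)). unfold rgauss.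
    apply Rabs_le_between in H'. lra.
  + intros x Hx. apply Rabs_le. split.
    * assert (c <= rgauss x + / x); [|lra]. apply Hc2. intros v [y [Hy ->]].
      destruct (Rle_dec x y) as [Hxy|Hxy]; [now apply rgauss_tail|].
      assert (rgauss y < rgauss x) by (apply rgauss_incr; lra).
      assert (0 < / x) by (apply Rinv_0_lt_compat; lra). lra.
    * assert (rgauss x <= c) by (apply Hc1; exists x; auto).
      assert (0 < / x) by (apply Rinv_0_lt_compat; lra). lra.
Qed.

(** The opening is narrow enough that [Re (z ^ 2) >= 3 / 4 * Re z ^ 2], so [cexp (- z ^ 2)] decays
    in it. *)
Definition sector (z : C) : Prop := Rabs (Im z) <= Re z / 2.

(** Mean value inequality on the vertical segment from [x] to [x + Ci * y], where the derivative is
    largest in modulus at the far end. *)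
Lemma gauss_sub_re x y : Cmod (gauss (x, y) - gauss x)%C <= exp (- x ^ 2 + y ^ 2) * Rabs y.
Proof.
replace (x, y) with (x + Ci * y)%C
  by (apply injective_projections; simpl; ring).
replace (Rabs y) with (Cmod (Ci * y)) by (rewrite Cmod_mult, Cmod_Ci, Cmod_R; ring).
apply mean_value with (df := fun z => cexp (- z ^ 2)).
- intros t _. apply cderiv_gauss.
- intros t Ht. rewrite Cmod_cexp.
  replace (Re _) with (- x ^ 2 + t ^ 2 * y ^ 2) by (simpl; ring).
  assert (t ^ 2 * y ^ 2 <= y ^ 2).
  { assert (t ^ 2 <= 1) by nra. assert (0 <= y ^ 2) by apply pow2_ge_0. nra. }
  destruct (Rle_lt_or_eq_dec (- x ^ 2 + t ^ 2 * y ^ 2) (- x ^ 2 + y ^ 2)) as [H1| ->]; [lra| |lra].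
  apply Rlt_le, exp_increasing, H1.
Qed.

(** For [Re z <= 1] the sector is bounded. Elsewhere a vertical move to the real axis and the real
    limit each cost at most [/ Re z], while [Cmod z <= 3 / 2 * Re z]. *)
Lemma gauss_sector : exists c B, 0 < c /\ 0 < B /\
  forall z, sector z -> Cmod (gauss z) <= B /\ Cmod z * Cmod (gauss z - c)%C <= B.
Proof.
destruct rgauss_lim as [c [Hc Hlim]].
set (M := 2 * exp 4). assert (HM : 0 < M) by (generalize (exp_pos 4); unfold M; lra).
(* [M] bounds [gauss] on the disc of radius 2, which contains the bounded part of the sector; there
   [2 * (M + c)] suffices. The summand 3 covers the product [3 / 2 * x * (2 / x)] in the other
   case. *)
exists c, (2 * (M + c) + 3). split; [auto|]. split; [lra|].
intros [x y] H. unfold sector in H. simpl in H.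
set (z := (x, y)).
assert (HX : Cmod z <= x + Rabs y).
{ replace z with (x + Ci * y)%C by (apply injective_projections; simpl; ring).
  eapply Rle_trans; [apply Cmod_triangle|].
  rewrite Cmod_mult, Cmod_Ci, !Cmod_R, (Rabs_pos_eq x); [lra|].
  generalize (Rabs_pos y); lra. }
assert (HX0 := Cmod_ge_0 z). assert (Hy := Rabs_pos y).
destruct (Rle_dec x 1) as [Hx|Hx].
- assert (HE : Cmod (gauss z) <= M).
  { eapply Rle_trans; [apply Cmod_gauss_le|]. unfold M.
    apply Rmult_le_compat; [auto|apply Rlt_le, exp_pos|lra|].
    assert (Cmod z ^ 2 <= 4) by nra.
    destruct (Rle_lt_or_eq_dec (Cmod z ^ 2) 4) as [H1| ->]; [lra| |lra].
    apply Rlt_le, exp_increasing, H1. }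
  assert (HE' : Cmod (gauss z - c)%C <= M + c).
  { eapply Rle_trans; [apply Cmod_triangle|]. rewrite Cmod_opp, Cmod_R, Rabs_pos_eq; lra. }
  split; [lra|]. assert (H0 := Cmod_ge_0 (gauss z - c)%C). nra.
- assert (Hx1 : 1 <= x) by lra. specialize (Hlim x Hx1).
  assert (Hv := gauss_sub_re x y). fold z in Hv.
  assert (Hix : / x * x = 1) by (apply Rinv_l; lra).
  assert (Hix0 : 0 < / x) by (apply Rinv_0_lt_compat; lra).
  assert (Hyx : y ^ 2 <= x ^ 2 / 4).
  { rewrite <- (Rabs_pos_eq (y ^ 2)), <- RPow_abs by apply pow2_ge_0. nra. }
  (* In the sector [Rabs y * x <= 1 + (x ^ 2 - y ^ 2)], and [exp_neg_le] bounds the exponential by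
     the inverse of the right side. *)
  assert (He : exp (- x ^ 2 + y ^ 2) * Rabs y <= / x).
  { assert (Hu := exp_neg_le (x ^ 2 - y ^ 2)).
    replace (- (x ^ 2 - y ^ 2)) with (- x ^ 2 + y ^ 2) in Hu by ring.
    assert (Hp := exp_pos (- x ^ 2 + y ^ 2)).
    assert (Hx2 : 1 <= x ^ 2) by nra.
    assert (Hu' : exp (- x ^ 2 + y ^ 2) * (1 + (x ^ 2 - y ^ 2)) <= 1) by (apply Hu; lra).
    apply Rmult_le_reg_r with x; [lra|]. rewrite Hix.
    eapply Rle_trans; [|apply Hu']. rewrite Rmult_assoc. apply Rmult_le_compat_l; [lra|].
    nra. }
  assert (HD : Cmod (gauss z - c)%C <= 2 * / x).
  { replace (gauss z - c)%C with ((gauss z - gauss x) + (gauss x - c))%C by ring.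
    eapply Rle_trans; [apply Cmod_triangle|].
    rewrite (gauss_RtoC x) at 2. rewrite <- RtoC_minus, Cmod_R. lra. }
  assert (Hix1 : / x <= 1) by nra.
  split.
  + replace (gauss z) with ((gauss z - c) + c)%C by ring.
    eapply Rle_trans; [apply Cmod_triangle|]. rewrite Cmod_R, (Rabs_pos_eq c); lra.
  + apply Rle_trans with (Cmod z * (2 * / x)); [now apply Rmult_le_compat_l|].
    apply Rle_trans with (3 / 2 * x * (2 * / x)); [apply Rmult_le_compat_r; lra|].
    replace (3 / 2 * x * (2 * / x)) with (3 * (/ x * x)) by (field; lra). rewrite Hix. lra.
Qed.

(** * Signs and directions *)

(** [true] encodes the base 16 digit 8, that is a half turn, hence the sign -1. *)
Definition bsign (b : bool) : R := if b then -1 else 1.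

Fixpoint rsum (d : nat -> R) (n : nat) : R :=
  match n with O => 0 | S n => rsum d n + d n end.

(* Distance left to the target [x] when every step [d n] is taken towards it. *)
Fixpoint remainder (x : R) (d : nat -> R) (n : nat) : R :=
  match n with
  | O => x
  | S n => if Rle_dec 0 (remainder x d n) then remainder x d n - d n
           else remainder x d n + d n
  end.

Lemma Rabs_remainder_S x d n : 0 <= d n ->
  Rabs (remainder x d (S n)) = Rabs (Rabs (remainder x d n) - d n).
Proof.
intros Hd. simpl. destruct (Rle_dec 0 (remainder x d n)) as [H|H].
- now rewrite (Rabs_pos_eq (remainder x d n)).
- rewrite (Rabs_left (remainder x d n)) by lra. rewrite <- (Rabs_Ropp (_ + _)).
  f_equal. ring.
Qed.

(** While the distance is at least [eps], each step shorter than [eps] reduces it by exactly [d n],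
    which cannot go on since the steps have a divergent sum. Once below [eps] it stays there,
    because [Rabs (r - d) < eps] when both [r] and [d] lie in [[0, eps)]. *)
Lemma remainder_lim x d :
  (forall j, 0 <= d j) ->
  (forall eps, 0 < eps -> exists J, forall j, (J <= j)%nat -> d j < eps) ->
  (forall M, exists J, M < rsum d J) ->
  forall eps, 0 < eps -> exists J, forall j, (J <= j)%nat -> Rabs (remainder x d j) < eps.
Proof.
intros Hd0 Hd Hdiv eps Heps. destruct (Hd eps Heps) as [J HJ].
assert (Hk : exists k, Rabs (remainder x d (J + k)) < eps).
{ destruct (Hdiv (Rabs (remainder x d J) + rsum d J)) as [K HK].
  assert (Hor : forall k, (exists k, Rabs (remainder x d (J + k)) < eps) \/
    Rabs (remainder x d (J + k)) = Rabs (remainder x d J) - (rsum d (J + k) - rsum d J)).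
  { induction k as [|k IH].
    - right. rewrite Nat.add_0_r. ring.
    - destruct IH as [IH|IH]; [now left|].
      destruct (Rlt_dec (Rabs (remainder x d (J + k))) eps) as [H|H]; [left; now exists k|].
      right. rewrite <- plus_n_Sm, Rabs_remainder_S by auto. simpl rsum.
      assert (d (J + k)%nat < eps) by (apply HJ; lia).
      rewrite Rabs_pos_eq; lra. }
  destruct (Nat.le_gt_cases J K) as [HJK|HJK].
  - destruct (Hor (K - J)%nat) as [H|H]; [auto|].
    replace (J + (K - J))%nat with K in H by lia.
    generalize (Rabs_pos (remainder x d K)); lra.
  (* The case [K < J] contradicts the choice of [K], since the partial sums are nondecreasing. *)
  - assert (Hmon : forall n, rsum d K <= rsum d (K + n)).
    { induction n as [|n IH]; [rewrite Nat.add_0_r; lra|].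
      rewrite <- plus_n_Sm. simpl. generalize (Hd0 (K + n)%nat); lra. }
    specialize (Hmon (J - K)%nat). replace (K + (J - K))%nat with J in Hmon by lia.
    generalize (Rabs_pos (remainder x d J)); lra. }
destruct Hk as [k Hk]. exists (J + k)%nat. intros j Hj.
replace j with (J + k + (j - (J + k)))%nat by lia.
induction (j - (J + k))%nat as [|n IH]; [now rewrite Nat.add_0_r|].
rewrite <- plus_n_Sm, Rabs_remainder_S by auto.
assert (d (J + k + n)%nat < eps) by (apply HJ; lia).
apply Rabs_def1; generalize (Rabs_pos (remainder x d (J + k + n))), (Hd0 (J + k + n)%nat); lra.
Qed.

(** * Harmonic weights split by parity *)

Definition even_part (d : nat -> R) (j : nat) : R := if Nat.even j then d j else 0.
Definition odd_part (d : nat -> R) (j : nat) : R := if Nat.even j then 0 else d j.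

Definition harm (j : nat) : R := / INR (S j).

Lemma harm_pos j : 0 < harm j.
Proof. apply Rinv_0_lt_compat, lt_0_INR. lia. Qed.

Lemma harm_small eps : 0 < eps -> exists J, forall j, (J <= j)%nat -> harm j < eps.
Proof.
intros Heps. destruct (archimed_cor1 eps Heps) as [J [HJ HJ0]]. exists J. intros j Hj.
eapply Rle_lt_trans; [|exact HJ]. apply Rinv_le_contravar; [now apply lt_0_INR|].
apply le_INR. lia.
Qed.

Lemma ln_S_sub k : ln (INR (S (S k))) - ln (INR (S k)) <= / INR (S k).
Proof.
assert (H : 0 < INR (S k)) by (apply lt_0_INR; lia).
assert (H0 : 0 < / INR (S k)) by now apply Rinv_0_lt_compat.
replace (INR (S (S k))) with (INR (S k) * (1 + / INR (S k)))
  by (rewrite (S_INR (S k)); field; lra).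
rewrite ln_mult by lra.
assert (ln (1 + / INR (S k)) <= / INR (S k)); [|lra].
rewrite <- (ln_exp (/ INR (S k))) at 2. apply ln_le; [lra|].
apply Rlt_le, exp_ineq1; lra.
Qed.

(** Each of the indices [2 * K] and [2 * K + 1] contributes at least [/ INR (S K) / 2] to the sum of
    its parity, which is at least half of the increment of [ln]. *)
Lemma rsum_harm_ge K :
  ln (INR (S K)) / 2 <= rsum (even_part harm) (2 * K) /\
  ln (INR (S K)) / 2 <= rsum (odd_part harm) (2 * K).
Proof.
induction K as [|K IH].
- simpl. rewrite ln_1. lra.
- replace (2 * S K)%nat with (S (S (2 * K))) by lia. simpl rsum.
  assert (E : Nat.even (2 * K) = true) by (rewrite Nat.even_mul; auto).
  assert (O : Nat.even (S (2 * K)) = false) by (rewrite Nat.even_succ, <- Nat.negb_even, E; auto).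
  unfold even_part at 2 3, odd_part at 2 3.
  replace (K + (K + 0))%nat with (2 * K)%nat by lia. rewrite E, O.
  assert (H := ln_S_sub K).
  assert (H2 : / INR (S K) / 2 = harm (S (2 * K))).
  { unfold harm. replace (S (S (2 * K))) with (2 * S K)%nat by lia.
    rewrite mult_INR. simpl (INR 2). field. apply not_0_INR. lia. }
  assert (H3 : harm (S (2 * K)) <= harm (2 * K)).
  { apply Rinv_le_contravar; [apply lt_0_INR; lia|apply le_INR; lia]. }
  split; lra.
Qed.

Lemma ln_INR_unbounded M : exists K, M < ln (INR (S K)).
Proof.
destruct (INR_unbounded (exp M)) as [K HK]. exists K.
rewrite <- (ln_exp M). apply ln_increasing; [apply exp_pos|].
rewrite S_INR. lra.
Qed.

Lemma rsum_even_harm_unbounded M : exists J, M < rsum (even_part harm) J.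
Proof.
destruct (ln_INR_unbounded (2 * M)) as [K HK]. exists (2 * K)%nat.
generalize (proj1 (rsum_harm_ge K)); lra.
Qed.

Lemma rsum_odd_harm_unbounded M : exists J, M < rsum (odd_part harm) J.
Proof.
destruct (ln_INR_unbounded (2 * M)) as [K HK]. exists (2 * K)%nat.
generalize (proj2 (rsum_harm_ge K)); lra.
Qed.

Lemma even_part_bounds j : 0 <= even_part harm j <= harm j.
Proof. unfold even_part. generalize (harm_pos j). destruct Nat.even; lra. Qed.

Lemma odd_part_bounds j : 0 <= odd_part harm j <= harm j.
Proof. unfold odd_part. generalize (harm_pos j). destruct Nat.even; lra. Qed.

Definition weight (j : nat) : C := (even_part harm j, odd_part harm j).

Lemma Cmod_weight j : Cmod (weight j) = harm j.
Proof.
unfold weight, even_part, odd_part, Cmod. simpl. generalize (harm_pos j).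
intros H. transitivity (sqrt (harm j ^ 2)); [|apply sqrt_pow2; lra].
destruct Nat.even; f_equal; ring.
Qed.

(** Two greedy approximations run independently: even indices correct the real part, odd ones the
    imaginary part. *)
Lemma signed_weight_sum (w : C) : exists b : nat -> bool,
  forall eps, 0 < eps -> exists J, forall n, (J <= n)%nat ->
    Cmod (psum (fun j => bsign (b j) * weight j)%C n - w)%C < eps.
Proof.
set (p := remainder (Re w) (even_part harm)). set (q := remainder (Im w) (odd_part harm)).
set (b := fun j => if Rle_dec 0 (if Nat.even j then p j else q j) then false else true).
exists b.
(* At an index of the other parity the step is 0, so both branches of [remainder] leave the distance
   unchanged. *)
assert (E : forall n, psum (fun j => bsign (b j) * weight j)%C n = (Re w - p n, Im w - q n)).
{ induction n as [|n IH].
  - unfold p, q. simpl. apply injective_projections; simpl; ring.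
  - simpl psum. rewrite IH. unfold p, q. simpl remainder. fold p. fold q.
    unfold b, weight, even_part, odd_part.
    destruct (Nat.even n).
    + destruct (Rle_dec 0 (p n)); destruct (Rle_dec 0 (q n));
      apply injective_projections; simpl; ring.
    + destruct (Rle_dec 0 (p n)); destruct (Rle_dec 0 (q n));
      apply injective_projections; simpl; ring. }
intros eps Heps.
destruct (remainder_lim (Re w) (even_part harm)) with (eps := eps / 2) as [J1 HJ1].
- apply even_part_bounds.
- intros e He. destruct (harm_small e He) as [J HJ]. exists J. intros j Hj.
  generalize (even_part_bounds j), (HJ j Hj); lra.
- apply rsum_even_harm_unbounded.
- lra.
- destruct (remainder_lim (Im w) (odd_part harm)) with (eps := eps / 2) as [J2 HJ2].
  + apply odd_part_bounds.
  + intros e He. destruct (harm_small e He) as [J HJ]. exists J. intros j Hj.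
    generalize (odd_part_bounds j), (HJ j Hj); lra.
  + apply rsum_odd_harm_unbounded.
  + lra.
  + exists (Nat.max J1 J2). intros n Hn.
    assert (H1 : Rabs (p n) < eps / 2) by (apply HJ1; lia).
    assert (H2 : Rabs (q n) < eps / 2) by (apply HJ2; lia).
    rewrite E.
    replace (_ - w)%C with (RtoC (- p n) + Ci * RtoC (- q n))%C
      by (apply injective_projections; simpl; unfold Re, Im; ring).
    eapply Rle_lt_trans; [apply Cmod_triangle|].
    rewrite Cmod_mult, Cmod_Ci, !Cmod_R, !Rabs_Ropp. lra.
Qed.

Lemma weight_sum_unbounded M : exists J, forall n, (J <= n)%nat ->
  M < Cmod (psum weight n).
Proof.
assert (E : forall n, Re (psum weight n) = rsum (even_part harm) n).
{ induction n as [|n IH]; [reflexivity|]. simpl psum. now rewrite re_plus, IH. }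
destruct (rsum_even_harm_unbounded M) as [J HJ]. exists J. intros n Hn.
eapply Rlt_le_trans; [|eapply Rle_trans; [apply Rle_abs|apply re_le_Cmod]].
rewrite E. replace n with (J + (n - J))%nat by lia.
induction (n - J)%nat as [|k IH]; [now rewrite Nat.add_0_r|].
rewrite <- plus_n_Sm. simpl. generalize (even_part_bounds (J + k)); lra.
Qed.

(** * Rays whose direction has prescribed base 16 digits *)

Definition digit (b : bool) : R := if b then 1 else 0.

(* [angle b 0 / (2 * PI)] has the base 16 expansion with digits 0 and 8 prescribed by [b]. *)
Definition angle (b : nat -> bool) (j : nat) : R :=
  PI * Series (fun i => digit (b (j + i)%nat) * (1 / 16) ^ i).

Lemma is_series_16 : is_series (fun i => (1 / 16) ^ i) (16 / 15).
Proof.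
replace (16 / 15) with (/ (1 - 1 / 16)) by field.
apply is_series_geom. rewrite Rabs_pos_eq; lra.
Qed.

Lemma digit_term_bounds b j i :
  0 <= digit (b (j + i)%nat) * (1 / 16) ^ i <= (1 / 16) ^ i.
Proof.
assert (0 <= (1 / 16) ^ i) by (apply pow_le; lra).
unfold digit. destruct b; lra.
Qed.

Lemma ex_series_digit b j : ex_series (fun i => digit (b (j + i)%nat) * (1 / 16) ^ i).
Proof.
apply ex_series_Rabs_le with (fun i => (1 / 16) ^ i); [eexists; apply is_series_16|].
intros n. rewrite Rabs_pos_eq; apply digit_term_bounds.
Qed.

Lemma angle_S b j : angle b j = PI * digit (b j) + angle b (S j) / 16.
Proof.
unfold angle. rewrite (Series_incr_1 _ (ex_series_digit b j)), Nat.add_0_r.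
rewrite (Series_ext _ (fun i => 1 / 16 * (digit (b (S j + i)%nat) * (1 / 16) ^ i))).
- rewrite Series_scal_l. simpl. field.
- intros n. rewrite <- plus_n_Sm. simpl. ring.
Qed.

(** The geometric series sums to [16 / 15], and [PI <= 4]. *)
Lemma angle_bounds b j : 0 <= angle b j / 16 <= 4 / 15.
Proof.
assert (H0 : 0 <= Series (fun i => digit (b (j + i)%nat) * (1 / 16) ^ i) <= 16 / 15).
{ split.
  - rewrite <- (Rmult_0_l (Series (fun _ => 0))), <- Series_scal_l.
    apply Series_le; [|apply ex_series_digit].
    intros n. rewrite Rmult_0_l. generalize (digit_term_bounds b j n); lra.
  - rewrite <- (is_series_unique _ _ is_series_16).
    apply Series_le; [|eexists; apply is_series_16]. apply digit_term_bounds. }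
assert (H1 := PI_RGT_0). assert (H2 := PI_4). unfold angle. split.
- assert (0 <= PI * Series (fun i => digit (b (j + i)%nat) * (1 / 16) ^ i)) by
    (apply Rmult_le_pos; lra). lra.
- assert (PI * Series (fun i => digit (b (j + i)%nat) * (1 / 16) ^ i) <= 4 * (16 / 15)) by
    (apply Rmult_le_compat; lra). lra.
Qed.

Definition expi (t : R) : C := (cos t, sin t).

Lemma Cmod_expi t : Cmod (expi t) = 1.
Proof.
unfold Cmod, expi. simpl.
replace (cos t * (cos t * 1) + sin t * (sin t * 1)) with 1; [apply sqrt_1|].
generalize (sin2_cos2 t). unfold Rsqr. lra.
Qed.

Lemma expi_pow t n : (expi t ^ n)%C = expi (INR n * t).
Proof.
induction n as [|n IH].
- simpl. unfold expi. now rewrite Rmult_0_l, cos_0, sin_0.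
- rewrite Cpow_S, IH, S_INR. unfold expi, Cmult. simpl.
  replace ((INR n + 1) * t) with (t + INR n * t) by ring.
  rewrite cos_plus, sin_plus. f_equal. ring.
Qed.

(** Multiplying the angle by 16 shifts the expansion by one place; the leading digit becomes 0 or 8
    full turns. *)
Lemma expi_angle_S b j : (expi (angle b j) ^ 16)%C = expi (angle b (S j)).
Proof.
rewrite expi_pow, (angle_S b j).
replace (INR 16 * (PI * digit (b j) + angle b (S j) / 16))
  with (angle b (S j) + 2 * INR (if b j then 8 else 0) * PI).
- unfold expi. now rewrite cos_period, sin_period.
- unfold digit. destruct (b j); simpl; field.
Qed.

Lemma expi_angle_pow b j : (expi (angle b 0) ^ (16 ^ j))%C = expi (angle b j).
Proof.
induction j as [|j IH].
- apply Cpow_1_r.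
- rewrite <- expi_angle_S, <- IH, <- Cpow_mult_r. f_equal. simpl. lia.
Qed.

Lemma sector_expi t : 0 <= t <= 4 / 15 -> sector (expi t).
Proof.
intros Ht. unfold sector, expi. simpl.
assert (H1 : 0 <= sin t) by (apply sin_ge_0; generalize PI2_3_2; unfold PI2; lra).
assert (H2 : sin t <= t).
{ destruct (proj1 Ht) as [H|<-]; [apply Rlt_le, sin_lt_x, H|rewrite sin_0; lra]. }
rewrite Rabs_pos_eq by auto.
assert (H3 : sin t * sin t <= 4 / 15 * (4 / 15)) by (apply Rmult_le_compat; lra).
assert (H4 := sin2_cos2 t). unfold Rsqr in H4.
assert (H5 : 0 <= cos t) by (apply cos_ge_0; generalize PI2_3_2; lra).
(* [8 / 15] is twice the bound on [sin t], exactly the slope of the sector; a smaller cosine would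
   contradict [sin2_cos2]. *)
assert (H6 : 8 / 15 <= cos t) by (destruct (Rle_dec (8 / 15) (cos t)); [auto|nra]).
lra.
Qed.

Lemma sector_scal x z : 0 <= x -> sector z -> sector (x * z)%C.
Proof.
unfold sector. intros Hx Hz. rewrite im_scal_l, re_scal_l, Rabs_mult, (Rabs_pos_eq x) by auto.
nra.
Qed.

(** The sign undoes the half turn given by the leading digit, and the remaining digits form an angle
    of at most [4 / 15]. *)
Lemma sector_expi_angle b j : sector (bsign (b j) * expi (angle b j))%C.
Proof.
replace (bsign (b j) * expi (angle b j))%C with (expi (angle b (S j) / 16)).
- apply sector_expi, angle_bounds.
- rewrite (angle_S b j). unfold bsign, digit, expi. destruct (b j).
  + rewrite Rmult_1_r, Rplus_comm, neg_cos, neg_sin.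
    apply injective_projections; simpl; ring.
  + rewrite Rmult_0_r, Rplus_0_l. apply injective_projections; simpl; ring.
Qed.

(** * The lacunary sum *)

(** For [rho N <= r <= rho (S N)] this gap makes [r / rho j] at least [4 ^ N] when [j < N] and at
    most [(1 / 4) ^ j] when [j > S N]; only the indices [N] and [S N] are uncontrolled. *)
Definition lacunary (rho : nat -> R) : Prop :=
  4 <= rho 0%nat /\ forall j, 4 ^ S j * rho j <= rho (S j).

Definition scaled (rho : nat -> R) (j : nat) (z : C) : C := ((/ rho j)%R * z)%C.

Definition term (rho : nat -> R) (j : nat) (z : C) : C :=
  (weight j * gauss (scaled rho j z ^ (16 ^ j)))%C.

Definition phi_of (rho : nat -> R) (z : C) : C := csum (fun j => term rho j z).

Lemma pow4_ge_1 n : 1 <= 4 ^ n.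
Proof. apply pow_R1_Rle. lra. Qed.

Lemma lacunary_ge rho j : lacunary rho -> 4 ^ S j <= rho j.
Proof.
intros [H0 H]. induction j as [|j IH]; [simpl; lra|].
specialize (H j). rewrite <- tech_pow_Rmult.
assert (H1 := pow4_ge_1 (S j)). assert (4 <= rho j).
{ assert (H2 := pow4_ge_1 j). rewrite <- tech_pow_Rmult in IH. lra. }
nra.
Qed.

Lemma lacunary_ge_4 rho j : lacunary rho -> 4 <= rho j.
Proof.
intros H. assert (H1 := lacunary_ge rho j H). assert (H2 := pow4_ge_1 j).
rewrite <- tech_pow_Rmult in H1. lra.
Qed.

Lemma lacunary_mono rho i j : lacunary rho -> (i <= j)%nat -> rho i <= rho j.
Proof.
intros H Hij. induction Hij as [|j Hij IH]; [lra|].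
assert (H1 := proj2 H j). assert (H2 := pow4_ge_1 (S j)).
assert (H3 := lacunary_ge_4 rho j H). nra.
Qed.

Lemma lacunary_ratio rho i j : lacunary rho -> (i < j)%nat -> 4 ^ j * rho i <= rho j.
Proof.
intros H Hij. destruct j as [|j]; [lia|].
apply Rle_trans with (4 ^ S j * rho j); [|apply H].
apply Rmult_le_compat_l; [generalize (pow4_ge_1 (S j)); lra|].
apply lacunary_mono; [auto|lia].
Qed.

Lemma lacunary_locate rho r : lacunary rho -> rho 0%nat <= r ->
  exists N, rho N <= r < rho (S N).
Proof.
intros H Hr.
assert (Hn : exists n, r < rho n).
{ destruct (Pow_x_infinity 4) with (b := r) as [n Hn]; [rewrite Rabs_pos_eq; lra|].
  exists n. specialize (Hn n (le_n n)). rewrite Rabs_pos_eq in Hn by (apply pow_le; lra).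
  assert (H1 := lacunary_ge rho n H). assert (H2 := pow4_ge_1 n).
  rewrite <- tech_pow_Rmult in H1. lra. }
destruct Hn as [n Hn]. induction n as [|n IH]; [lra|].
destruct (Rlt_dec r (rho n)) as [H1|H1]; [auto|].
exists n. split; lra.
Qed.

Lemma Cmod_scaled rho j z : lacunary rho -> Cmod (scaled rho j z) = Cmod z / rho j.
Proof.
intros H. assert (H1 := lacunary_ge_4 rho j H). unfold scaled.
rewrite Cmod_mult, Cmod_R, Rabs_pos_eq; [unfold Rdiv; ring|].
apply Rlt_le, Rinv_0_lt_compat. lra.
Qed.

Lemma pow_le_1 q n : 0 <= q <= 1 -> 0 <= q ^ n <= 1.
Proof.
intros Hq. split; [apply pow_le; lra|]. rewrite <- (pow1 n). apply pow_incr. lra.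
Qed.

Lemma pow_le_base q n : 0 <= q <= 1 -> (1 <= n)%nat -> q ^ n <= q.
Proof.
intros Hq Hn. destruct n as [|n]; [lia|]. simpl.
assert (H := pow_le_1 q n Hq). nra.
Qed.

Lemma base_le_pow q n : 1 <= q -> (1 <= n)%nat -> q <= q ^ n.
Proof.
intros Hq Hn. destruct n as [|n]; [lia|]. simpl.
assert (1 <= q ^ n) by (apply pow_R1_Rle; lra). nra.
Qed.

Lemma pow16_ge_1 j : (1 <= 16 ^ j)%nat.
Proof. apply Nat.neq_0_lt_0, Nat.pow_nonzero. lia. Qed.

Lemma exp_le_exp x y : x <= y -> exp x <= exp y.
Proof. intros [H| ->]; [now apply Rlt_le, exp_increasing|lra]. Qed.

Lemma harm_le_1 j : harm j <= 1.
Proof.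
unfold harm. rewrite <- Rinv_1. apply Rinv_le_contravar; [lra|]. apply (le_INR 1). lia.
Qed.

Lemma Cmod_weight_mult_le j z : Cmod (weight j * z) <= Cmod z.
Proof.
rewrite Cmod_mult, Cmod_weight. generalize (Cmod_ge_0 z), (harm_le_1 j), (harm_pos j). nra.
Qed.

Lemma mult_exp_sqr_le x y : 0 <= x <= y -> x * exp (x ^ 2) <= y * exp (y ^ 2).
Proof.
intros H. apply Rmult_le_compat; [lra|apply Rlt_le, exp_pos|lra|].
apply exp_le_exp, pow_incr, H.
Qed.

Lemma exp_sqr_le_3 x : 0 <= x <= 1 -> exp (x ^ 2) <= 3.
Proof.
intros H. apply Rle_trans with (exp 1); [|apply exp_le_3].
apply exp_le_exp, pow_le_1, H.
Qed.

(** The free bound [q] lets the estimate serve both negligible terms, with [q] a power of [1 / 4],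
    and large ones, with [q] equal to 1 or [Cmod z]. *)
Lemma Cmod_term_le rho j z q : lacunary rho -> Cmod z / rho j <= q ->
  Cmod (term rho j z) <= q ^ (16 ^ j) * exp ((q ^ (16 ^ j)) ^ 2).
Proof.
intros H Hq. unfold term. eapply Rle_trans; [apply Cmod_weight_mult_le|].
eapply Rle_trans; [apply Cmod_gauss_le|].
rewrite Cmod_pow, Cmod_scaled by auto.
apply mult_exp_sqr_le.
assert (H0 : 0 <= Cmod z / rho j).
{ apply Rdiv_le_0_compat; [apply Cmod_ge_0|]. generalize (lacunary_ge_4 rho j H); lra. }
split; [now apply pow_le|]. now apply pow_incr.
Qed.

Lemma mult_exp_sqr_pow_le q n : 0 <= q <= 1 -> (1 <= n)%nat ->
  q ^ n * exp ((q ^ n) ^ 2) <= 3 * q.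
Proof.
intros Hq Hn. assert (H1 := pow_le_base q n Hq Hn).
assert (H2 : 0 <= q ^ n) by (apply pow_le; lra).
assert (H3 : exp ((q ^ n) ^ 2) <= 3) by (apply exp_sqr_le_3; lra).
assert (H4 := exp_pos ((q ^ n) ^ 2)). nra.
Qed.

Lemma pow_inv_4_le j : / 4 ^ j = (1 / 4) ^ j.
Proof. rewrite <- pow_inv. f_equal. lra. Qed.

Lemma pow_half_sqr j : (1 / 4) ^ j = (1 / 2) ^ j * (1 / 2) ^ j.
Proof. rewrite <- Rpow_mult_distr. f_equal. lra. Qed.

Lemma ratio_le rho j r : lacunary rho -> r * 4 ^ j <= rho j -> r / rho j <= (1 / 4) ^ j.
Proof.
intros H Hr. assert (H1 := lacunary_ge_4 rho j H). assert (H2 := pow4_ge_1 j).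
rewrite <- pow_inv_4_le. apply Rmult_le_reg_r with (rho j); [lra|].
unfold Rdiv. rewrite Rmult_assoc, Rinv_l, Rmult_1_r by lra.
apply Rmult_le_reg_l with (4 ^ j); [lra|].
rewrite <- Rmult_assoc, Rinv_r; lra.
Qed.

Lemma pow_quarter_le_1 j : 0 <= (1 / 4) ^ j <= 1.
Proof. apply pow_le_1. lra. Qed.

Lemma Cmod_term_small rho N z n : lacunary rho -> Cmod z <= rho (S N) ->
  Cmod (term rho (S (S N) + n) z) <= (1 / 2) ^ N * (1 / 2) ^ n.
Proof.
intros H Hz. set (j := (S (S N) + n)%nat).
assert (Hq : Cmod z / rho j <= (1 / 4) ^ j).
{ apply ratio_le; [auto|]. assert (H1 : 4 ^ j * rho (S N) <= rho j)
    by (apply lacunary_ratio; [auto|unfold j; lia]).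
  generalize (pow4_ge_1 j). nra. }
eapply Rle_trans; [apply Cmod_term_le; eauto|].
eapply Rle_trans; [apply mult_exp_sqr_pow_le; [apply pow_quarter_le_1|apply pow16_ge_1]|].
rewrite pow_half_sqr. unfold j. simpl. rewrite pow_add.
set (x := (1 / 2) ^ N). set (y := (1 / 2) ^ n).
assert (0 <= x * y <= 1).
{ assert (0 <= x <= 1) by (apply pow_le_1; lra).
  assert (0 <= y <= 1) by (apply pow_le_1; lra).
  nra. }
(* The two extra indices in [S (S N) + n] give the factor [1 / 16], which absorbs the 3; one of the
   two factors [x * y <= 1] is then dropped. *)
replace (3 * _) with (3 / 16 * (x * y) * (x * y)) by field.
set (p := x * y) in *. nra.
Qed.

Lemma is_series_half : is_series (fun n => (1 / 2) ^ n) 2.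
Proof.
assert (H := is_series_geom (1 / 2)).
replace (/ (1 - 1 / 2)) with 2 in H by field.
apply H. rewrite Rabs_pos_eq; lra.
Qed.

Lemma phi_tail rho N z : lacunary rho -> Cmod z <= rho (S N) ->
  Cmod (phi_of rho z - psum (fun j => term rho j z) (S (S N)))%C <= 2 * (1 / 2) ^ N.
Proof.
intros H Hz.
replace (2 * (1 / 2) ^ N) with (Series (fun n => (1 / 2) ^ N * (1 / 2) ^ n)).
- apply csum_tail. split.
  + apply ex_series_Rmult_l. eexists; apply is_series_half.
  + intros n. now apply Cmod_term_small.
- rewrite (Series_scal_l _ (pow (1 / 2))), (is_series_unique (pow (1 / 2)) _ is_series_half). ring.
Qed.

Definition dterm (rho : nat -> R) (j : nat) (z : C) : C :=
  (weight j * (((/ rho j)%R * (INR (16 ^ j) * scaled rho j z ^ pred (16 ^ j)))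
     * cexp (- (scaled rho j z ^ (16 ^ j)) ^ 2)))%C.

Lemma cderiv_term rho j z : cderiv (term rho j) z (dterm rho j z).
Proof.
apply cderiv_scal.
apply (cderiv_comp gauss (fun z => scaled rho j z ^ (16 ^ j))%C).
- apply (cderiv_comp (fun z => z ^ (16 ^ j))%C (scaled rho j)).
  + assert (H := cderiv_scal (/ rho j)%R _ _ _ (cderiv_id z)).
    rewrite Cmult_1_r in H. exact H.
  + apply cderiv_pow.
- apply cderiv_gauss.
Qed.

Lemma INR_le_pow4 n : INR (S n) <= 4 ^ n.
Proof.
induction n as [|n IH]; [simpl; lra|]. rewrite S_INR. simpl pow. generalize (pow4_ge_1 n); lra.
Qed.

Lemma Cmod_dterm_le rho j z q : lacunary rho -> Cmod z / rho j <= q ->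
  Cmod (dterm rho j z) <=
    / rho j * (INR (16 ^ j) * q ^ pred (16 ^ j)) * exp ((q ^ (16 ^ j)) ^ 2).
Proof.
intros H Hq. assert (Hr := lacunary_ge_4 rho j H).
assert (H0 : 0 <= Cmod z / rho j).
{ apply Rdiv_le_0_compat; [apply Cmod_ge_0|lra]. }
assert (Hi : 0 < / rho j) by (apply Rinv_0_lt_compat; lra).
assert (Hn : 0 <= INR (16 ^ j)) by apply pos_INR.
unfold dterm. eapply Rle_trans; [apply Cmod_weight_mult_le|].
rewrite !Cmod_mult, Cmod_cexp, Cmod_pow, Cmod_scaled, !Cmod_R, !Rabs_pos_eq by (auto; lra).
apply Rmult_le_compat.
- apply Rmult_le_pos; [lra|]. apply Rmult_le_pos; [auto|now apply pow_le].
- apply Rlt_le, exp_pos.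
- apply Rmult_le_compat_l; [lra|]. apply Rmult_le_compat_l; [auto|].
  now apply pow_incr.
- apply exp_le_exp. eapply Rle_trans; [apply Rle_abs|].
  eapply Rle_trans; [apply re_le_Cmod|]. rewrite Cmod_opp, !Cmod_pow, Cmod_scaled by auto.
  apply pow_incr. split; [now apply pow_le|now apply pow_incr].
Qed.

Lemma cderiv_phi rho z : lacunary rho ->
  cderiv (phi_of rho) z (csum (fun j => dterm rho j z)).
Proof.
intros H. apply (cderiv_csum (term rho) (dterm rho)); [intros; apply cderiv_term|].
intros r Hr.
set (q := fun j => r / rho j).
assert (Hq0 : forall j, 0 <= q j).
{ intros j. apply Rdiv_le_0_compat; [lra|]. generalize (lacunary_ge_4 rho j H); lra. }
assert (Hi : forall j, 0 < / rho j).
{ intros j. apply Rinv_0_lt_compat. generalize (lacunary_ge_4 rho j H); lra. }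
set (b1 := fun j => q j ^ (16 ^ j) * exp ((q j ^ (16 ^ j)) ^ 2)).
set (b2 := fun j => / rho j * (INR (16 ^ j) * q j ^ pred (16 ^ j))
  * exp ((q j ^ (16 ^ j)) ^ 2)).
assert (Hb1 : forall j, 0 <= b1 j).
{ intros j. apply Rmult_le_pos; [now apply pow_le|apply Rlt_le, exp_pos]. }
assert (Hb2 : forall j, 0 <= b2 j).
{ intros j. apply Rmult_le_pos; [|apply Rlt_le, exp_pos].
  apply Rmult_le_pos; [apply Rlt_le, Hi|]. apply Rmult_le_pos; [apply pos_INR|].
  now apply pow_le. }
exists (fun j => b1 j + b2 j). split.
(* From the first index after such a [J] on, [q j] and [/ rho j] are at most [(1 / 4) ^ j]; the
   terms and their derivatives each contribute 3 to the constant 6. *)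
- destruct (Pow_x_infinity 4) with (b := r) as [J HJ]; [rewrite Rabs_pos_eq; lra|].
  specialize (HJ J (le_n J)). rewrite Rabs_pos_eq in HJ by (apply pow_le; lra).
  assert (HJ' : r <= rho J).
  { assert (H1 := lacunary_ge rho J H). assert (H2 := pow4_ge_1 J).
    rewrite <- tech_pow_Rmult in H1. lra. }
  apply (ex_series_incr_n _ (S J)).
  apply ex_series_Rabs_le with (fun n => 6 * (1 / 4) ^ n).
  + apply ex_series_Rmult_l. eexists. apply is_series_geom. rewrite Rabs_pos_eq; lra.
  + intros n. set (j := (S J + n)%nat).
    rewrite Rabs_pos_eq by (generalize (Hb1 j), (Hb2 j); lra).
    assert (Hq : q j <= (1 / 4) ^ j).
    { apply ratio_le; [auto|]. assert (H1 : 4 ^ j * rho J <= rho j)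
        by (apply lacunary_ratio; [auto|unfold j; lia]).
      generalize (pow4_ge_1 j). nra. }
    assert (Hj : (1 / 4) ^ j <= (1 / 4) ^ n).
    { unfold j. rewrite pow_add. generalize (pow_quarter_le_1 (S J)), (pow_quarter_le_1 n); nra. }
    assert (Hj' : (1 / 4) ^ j <= 1 / 4).
    { unfold j. simpl. generalize (pow_quarter_le_1 (J + n)); lra. }
    assert (B1 : b1 j <= 3 * q j).
    { apply mult_exp_sqr_pow_le; [generalize (Hq0 j); lra|apply pow16_ge_1]. }
    assert (B2 : b2 j <= 3 * / rho j).
    { unfold b2. assert (Hm := pow16_ge_1 j).
      (* With [16 ^ j = S m], the exponent [m] gives [(1 / 4) ^ m], which compensates
         [INR (S m) <= 4 ^ m]. *)
      assert (E1 : INR (16 ^ j) * q j ^ pred (16 ^ j) <= 1).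
      { destruct (16 ^ j)%nat as [|m]; [lia|]. simpl pred.
        apply Rle_trans with (4 ^ m * (1 / 4) ^ m).
        - apply Rmult_le_compat; [apply pos_INR|now apply pow_le|apply INR_le_pow4|].
          apply pow_incr. generalize (Hq0 j); lra.
        - rewrite <- Rpow_mult_distr. replace (4 * (1 / 4)) with 1 by field. rewrite pow1. lra. }
      assert (E2 : exp ((q j ^ (16 ^ j)) ^ 2) <= 3).
      { apply exp_sqr_le_3. split; [now apply pow_le|].
        eapply Rle_trans; [apply pow_le_base; [generalize (Hq0 j); lra|exact Hm]|lra]. }
      assert (E3 : 0 <= INR (16 ^ j) * q j ^ pred (16 ^ j)).
      { apply Rmult_le_pos; [apply pos_INR|now apply pow_le]. }
      assert (E4 := exp_pos ((q j ^ (16 ^ j)) ^ 2)). specialize (Hi j).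
      set (u := INR (16 ^ j) * q j ^ pred (16 ^ j)) in *.
      set (v := exp ((q j ^ (16 ^ j)) ^ 2)) in *.
      replace (/ rho j * u * v) with (/ rho j * (u * v)) by ring.
      replace (3 * / rho j) with (/ rho j * 3) by ring.
      apply Rmult_le_compat_l; [lra|]. nra. }
    assert (B3 : / rho j <= (1 / 4) ^ j).
    { assert (E := ratio_le rho j 1 H). unfold Rdiv at 1 in E. rewrite !Rmult_1_l in E.
      apply E. assert (H1 := lacunary_ge rho j H). rewrite <- tech_pow_Rmult in H1.
      generalize (pow4_ge_1 j). lra. }
    lra.
- intros j x Hx.
  assert (Hxq : Cmod x / rho j <= q j).
  { apply Rmult_le_compat_r; [apply Rlt_le, Hi|auto]. }
  split.
  + apply Rle_trans with (b1 j); [now apply Cmod_term_le|generalize (Hb2 j); lra].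
  + apply Rle_trans with (b2 j); [now apply Cmod_dterm_le|generalize (Hb1 j); lra].
Qed.

Lemma entire_phi rho : lacunary rho -> entire (phi_of rho).
Proof. intros H z. eapply cderiv_ex_derive, cderiv_phi, H. Qed.

(** * Growth of the lacunary sum *)

Lemma S_le_exp u : 0 <= u -> 1 + u <= exp u.
Proof.
intros [Hu|<-]; [apply Rlt_le, exp_ineq1; lra|rewrite exp_0; lra].
Qed.

(** With [X] the power [Cmod z ^ (16 ^ N)], each of the first [N + 2] terms is at most
    [X * exp (X ^ 2)], and the tail is at most 2. *)
Lemma Cmod_phi_le rho N z : lacunary rho -> rho N <= Cmod z <= rho (S N) ->
  Cmod (phi_of rho z) <= exp ((Cmod z ^ (16 ^ N)) ^ 3).
Proof.
intros H Hz. set (r := Cmod z) in *. set (X := r ^ (16 ^ N)).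
assert (Hr : 4 ^ S N <= r) by (generalize (lacunary_ge rho N H); lra).
assert (Hr1 : 4 <= r) by (generalize (lacunary_ge_4 rho N H); lra).
assert (HX : r <= X) by (apply base_le_pow; [lra|apply pow16_ge_1]).
assert (T := phi_tail rho N z H (proj2 Hz)).
assert (P : Cmod (psum (fun j => term rho j z) (S (S N))) <= INR (S (S N)) * (X * exp (X ^ 2))).
{ apply psum_le. intros j Hj. assert (Hj4 := lacunary_ge_4 rho j H).
  (* The term of index [S N] has the exponent [16 ^ S N], too large for the bound [r], but there
     [r / rho j <= 1]. *)
  assert (Hq : exists q, r / rho j <= q /\ 0 <= q ^ (16 ^ j) <= X).
  { destruct (Nat.eq_dec j (S N)) as [->|Hj'].
    - exists 1. rewrite pow1. split; [|lra].
      apply Rmult_le_reg_r with (rho (S N)); [lra|].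
      unfold Rdiv. rewrite Rmult_assoc, Rinv_l; lra.
    - exists r. split.
      + apply Rmult_le_reg_r with (rho j); [lra|].
        unfold Rdiv. rewrite Rmult_assoc, Rinv_l by lra. nra.
      + split; [apply pow_le; lra|]. apply Rle_pow; [lra|].
        apply Nat.pow_le_mono_r; lia. }
  destruct Hq as [q [Hq1 Hq2]].
  eapply Rle_trans; [apply Cmod_term_le; eauto|]. now apply mult_exp_sqr_le. }
(* The number of terms is absorbed into one more factor [X]. *)
assert (HN : INR (S (S N)) <= X) by (generalize (INR_le_pow4 (S N)); lra).
assert (Hh : (1 / 2) ^ N <= 1) by (apply pow_le_1; lra).
assert (HE1 := S_le_exp (2 * X ^ 2)).
assert (HX2 : 16 <= X ^ 2) by nra.
assert (HE0 := exp_pos (X ^ 2)).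
assert (HE2 : 1 <= exp (X ^ 2)) by (generalize (S_le_exp (X ^ 2)); lra).
apply Rle_trans with (X ^ 2 * exp (X ^ 2) + 2).
- replace (phi_of rho z) with
    (psum (fun j => term rho j z) (S (S N)) +
      (phi_of rho z - psum (fun j => term rho j z) (S (S N))))%C by ring.
  eapply Rle_trans; [apply Cmod_triangle|].
  assert (INR (S (S N)) * (X * exp (X ^ 2)) <= X * (X * exp (X ^ 2))).
  { apply Rmult_le_compat_r; [nra|auto]. }
  replace (X ^ 2 * exp (X ^ 2)) with (X * (X * exp (X ^ 2))) by ring. lra.
(* The polynomial factor and the summand 2 fit into [exp (2 * X ^ 2)], and [3 * X ^ 2 <= X ^ 3]
   since [X >= 4]. *)
- apply Rle_trans with (exp (2 * X ^ 2) * exp (X ^ 2)); [nra|].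
  rewrite <- exp_plus. apply exp_le_exp. nra.
Qed.

(** [0 <= B] settles the infinite values of [Lub_Rbar], which [real] sends to 0; for instance the
    set is empty when [r < 0]. *)
Lemma maxmod_le r f B : 0 <= B -> (forall z, Cmod z = r -> Cmod (f z) <= B) -> maxmod r f <= B.
Proof.
intros HB H. unfold maxmod.
destruct (Lub_Rbar_correct (fun y => exists z : C, Cmod z = r /\ y = Cmod (f z))) as [_ Hl].
specialize (Hl (Finite B)).
destruct (Lub_Rbar _) as [l| |]; simpl in *.
- apply Hl. intros y [z [Hz ->]]. now apply H.
- lra.
- lra.
Qed.

(** [ln] takes the value 0 at nonpositive arguments, so no lower bound on the maximum modulus or its
    logarithm is required. *)
Lemma ln_le_of_le_exp x y : 0 <= y -> x <= exp y -> ln x <= y.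
Proof.
intros Hy Hx. destruct (Rlt_dec 0 x) as [H|H].
- rewrite <- (ln_exp y). now apply ln_le.
- unfold ln. destruct (Rlt_dec 0 x); [contradiction|auto].
Qed.

Lemma phi_growth rho G : lacunary rho ->
  (forall j r, rho j <= r -> 3 * INR (16 ^ j) < G r) ->
  forall r, rho 0%nat < r -> ln (ln (maxmod r (phi_of rho))) < G r * ln r.
Proof.
intros H HG r Hr.
destruct (lacunary_locate rho r H) as [N HN]; [lra|].
assert (Hr4 : 4 < r) by (generalize (lacunary_ge_4 rho 0 H); lra).
assert (Hln : 0 < ln r) by (rewrite <- ln_1; apply ln_increasing; lra).
apply Rle_lt_trans with (3 * INR (16 ^ N) * ln r);
  [|apply Rmult_lt_compat_r; [auto|apply HG; lra]].
assert (Hp : 0 < r ^ (16 ^ N)) by (apply pow_lt; lra).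
apply ln_le_of_le_exp.
- apply Rmult_le_pos; [|lra]. generalize (pos_INR (16 ^ N)); lra.
- replace (exp (3 * INR (16 ^ N) * ln r)) with ((r ^ (16 ^ N)) ^ 3).
  + apply ln_le_of_le_exp; [apply Rlt_le, pow_lt; auto|].
    apply maxmod_le; [apply Rlt_le, exp_pos|].
    intros z Hz. rewrite <- Hz. apply Cmod_phi_le; [auto|]. rewrite Hz. lra.
  + rewrite <- (exp_ln ((r ^ (16 ^ N)) ^ 3)) by now apply pow_lt.
    f_equal. rewrite !ln_pow by (auto; lra). simpl (INR 3). ring.
Qed.

(** * Asymptotic values *)

Lemma gauss_sign b z : gauss z = (bsign b * gauss (bsign b * z))%C.
Proof.
destruct b; simpl.
- replace (RtoC (-1)) with (- (1))%C by (apply injective_projections; simpl; ring).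
  replace (- (1) * z)%C with (- z)%C by ring. rewrite gauss_opp. ring.
- rewrite !Cmult_1_l. reflexivity.
Qed.

Lemma term_on_ray rho b j (t : R) :
  term rho j (t * expi (angle b 0)) =
  (bsign (b j) * weight j *
     gauss (((/ rho j * t) ^ (16 ^ j))%R * (bsign (b j) * expi (angle b j))))%C.
Proof.
unfold term, scaled.
replace ((/ rho j)%R * (t * expi (angle b 0)))%C
  with ((/ rho j * t)%R * expi (angle b 0))%C by (rewrite RtoC_mult; ring).
rewrite Cpow_mult_l, expi_angle_pow, <- RtoC_pow, (gauss_sign (b j)).
rewrite Cmult_assoc, (Cmult_comm (weight j)). do 2 f_equal. ring.
Qed.

Lemma pow_half_le n : (1 / 2) ^ n <= / INR (S n).
Proof.
assert (H : INR (S n) <= 2 ^ n).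
{ induction n as [|n IH]; [simpl; lra|]. rewrite S_INR. simpl pow.
  assert (1 <= 2 ^ n) by (apply pow_R1_Rle; lra). lra. }
replace (1 / 2) with (/ 2) by field. rewrite pow_inv.
apply Rinv_le_contravar; [apply lt_0_INR; lia|auto].
Qed.

Lemma INR_mult_inv_pow4 n : INR n * / 4 ^ n <= harm n.
Proof.
rewrite pow_inv_4_le, pow_half_sqr. fold (harm n).
assert (H := pow_half_le n). fold (harm n) in H.
assert (H1 : 0 <= (1 / 2) ^ n) by (apply pow_le; lra).
assert (H2 : INR n * (1 / 2) ^ n <= 1).
{ apply Rle_trans with (INR n * harm n).
  - apply Rmult_le_compat_l; [apply pos_INR|auto].
  - unfold harm. apply Rmult_le_reg_r with (INR (S n)); [apply lt_0_INR; lia|].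
    rewrite Rmult_assoc, Rinv_l by (apply not_0_INR; lia). rewrite S_INR. lra. }
assert (H3 := pos_INR n). nra.
Qed.

(** Terms before [N] lie within [B / 4 ^ N] of their limits, which costs [B * harm N] in total. The
    terms [N] and [S N] cost at most [B * harm N] each, and the tail [2 * (1 / 2) ^ N] at most
    [2 * harm N]. *)
Lemma phi_on_ray rho b (c B : R) N (t : R) : lacunary rho ->
  (forall z, sector z -> Cmod (gauss z) <= B /\ Cmod z * Cmod (gauss z - c)%C <= B) ->
  rho N <= t <= rho (S N) ->
  Cmod (phi_of rho (t * expi (angle b 0)) -
    c * psum (fun j => bsign (b j) * weight j) N)%C <= (3 * B + 2) * harm N.
Proof.
intros H HB Ht. set (z := (t * expi (angle b 0))%C).
assert (Ht4 : 4 <= t) by (generalize (lacunary_ge_4 rho N H); lra).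
assert (Hz : Cmod z = t).
{ unfold z. rewrite Cmod_mult, Cmod_expi, Cmod_R, Rabs_pos_eq; lra. }
assert (T := phi_tail rho N z H). rewrite Hz in T. specialize (T (proj2 Ht)).
assert (HB0 : 0 <= B).
{ destruct (HB 0%C) as [H1 _]; [unfold sector; simpl; rewrite Rabs_R0; lra|].
  generalize (Cmod_ge_0 (gauss 0)); lra. }
assert (Hi : forall j, 0 < / rho j).
{ intros j. apply Rinv_0_lt_compat. generalize (lacunary_ge_4 rho j H); lra. }
assert (Hx : forall j, 0 <= / rho j * t).
{ intros j. specialize (Hi j). nra. }
assert (Hs : forall j, sector (((/ rho j * t) ^ (16 ^ j))%R * (bsign (b j) * expi (angle b j)))%C).
{ intros j. apply sector_scal; [apply pow_le, Hx|apply sector_expi_angle]. }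
assert (Hsg : forall j, Cmod (bsign (b j)) = 1).
{ intros j. rewrite Cmod_R. unfold bsign. destruct (b j); [rewrite Rabs_left; lra|apply Rabs_R1]. }
assert (Hterm : forall j, Cmod (term rho j z) <= harm j * B).
{ intros j. unfold z. rewrite term_on_ray, !Cmod_mult, Hsg, Cmod_weight, Rmult_1_l.
  apply Rmult_le_compat_l; [apply Rlt_le, harm_pos|]. apply HB, Hs. }
set (a := fun j => (term rho j z + - c * (bsign (b j) * weight j))%C).
assert (Ha : Cmod (psum a N) <= INR N * (B * / 4 ^ N)).
{ apply psum_le. intros j Hj. unfold a, z. rewrite term_on_ray.
  set (w := (((/ rho j * t) ^ (16 ^ j))%R * (bsign (b j) * expi (angle b j)))%C).
  replace (bsign (b j) * weight j * gauss w + - c * (bsign (b j) * weight j))%C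
    with (bsign (b j) * (weight j * (gauss w - c)))%C by ring.
  rewrite Cmod_mult, Hsg, Rmult_1_l.
  eapply Rle_trans; [apply Cmod_weight_mult_le|].
  assert (Hw : 4 ^ N <= Cmod w).
  { unfold w. rewrite !Cmod_mult, Hsg, Cmod_expi, Cmod_R, !Rmult_1_r, Rabs_pos_eq
      by apply pow_le, Hx.
    assert (H1 := lacunary_ratio rho j N H Hj).
    assert (H2 : 4 ^ N <= / rho j * t).
    { assert (H4 := lacunary_ge_4 rho j H). apply Rmult_le_reg_l with (rho j); [lra|].
      rewrite <- Rmult_assoc, Rinv_r; lra. }
    eapply Rle_trans; [exact H2|]. apply base_le_pow; [|apply pow16_ge_1].
    generalize (pow4_ge_1 N); lra. }
  destruct (HB w (Hs j)) as [_ HBw]. assert (H4 := pow4_ge_1 N).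
  apply Rmult_le_reg_l with (4 ^ N); [lra|].
  replace (4 ^ N * (B * / 4 ^ N)) with B by (field; lra).
  eapply Rle_trans; [|exact HBw]. apply Rmult_le_compat_r; [apply Cmod_ge_0|auto]. }
assert (E : (phi_of rho z - c * psum (fun j => bsign (b j) * weight j) N)%C =
  (psum a N + (term rho N z + term rho (S N) z) +
    (phi_of rho z - psum (fun j => term rho j z) (S (S N))))%C).
{ unfold a. rewrite psum_plus, psum_scal. simpl psum. ring. }
rewrite E.
eapply Rle_trans; [apply Cmod_triangle|].
assert (G1 := Cmod_triangle (psum a N) (term rho N z + term rho (S N) z)%C).
assert (G2 := Cmod_triangle (term rho N z) (term rho (S N) z)).
assert (G3 := Hterm N). assert (G4 := Hterm (S N)).
assert (G5 : harm (S N) <= harm N).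
{ apply Rinv_le_contravar; [apply lt_0_INR; lia|apply le_INR; lia]. }
assert (G6 := INR_mult_inv_pow4 N).
assert (G7 := pow_half_le N). fold (harm N) in G7.
assert (G8 : INR N * (B * / 4 ^ N) <= harm N * B).
{ replace (INR N * (B * / 4 ^ N)) with (INR N * / 4 ^ N * B) by ring.
  now apply Rmult_le_compat_r. }
assert (G9 : harm (S N) * B <= harm N * B) by now apply Rmult_le_compat_r.
lra.
Qed.

Lemma ray_path_to_infty u : Cmod u = 1 -> path_to_infty (fun t : R => (t * u)%C).
Proof.
intros Hu. split; [|split].
- intros t Ht. apply filterlim_locally. intros eps.
  (* Neighbourhoods in [C] come from the product structure, whose balls are squares; this lemma
     reduces membership to a bound on the modulus. *)
  exists eps. intros s Hs _. apply C_NormedModule_mixin_compat1.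
  change (Cmod (s * u - t * u)%C < eps).
  replace (s * u - t * u)%C with ((s - t)%R * u)%C by (rewrite RtoC_minus; ring).
  rewrite Cmod_mult, Hu, Rmult_1_r, Cmod_R. exact Hs.
- apply Cmult_0_l.
- intros P [M HM]. exists M. intros t Ht. apply HM.
  rewrite Cmod_mult, Hu, Rmult_1_r, Cmod_R.
  eapply Rlt_le_trans; [exact Ht|apply Rle_abs].
Qed.

Lemma lacunary_exists (A : nat -> R) : exists rho, lacunary rho /\ forall j, A j < rho j.
Proof.
set (rho := fix rho j := match j with
  | O => Rmax 4 (A O + 1)
  | S i => Rmax (4 ^ S i * rho i) (A (S i) + 1) end).
exists rho. split; [split|].
- apply Rmax_l.
- intros j. apply Rmax_l.
- intros [|j]; (eapply Rlt_le_trans; [|apply Rmax_r]); lra.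
Qed.

Lemma ray_eventually rho (P : nat -> R -> Prop) K : lacunary rho ->
  (forall N t, (K <= N)%nat -> rho N <= t <= rho (S N) -> P N t) ->
  forall t, rho K < t -> exists N, (K <= N)%nat /\ P N t.
Proof.
intros H HP t Ht.
destruct (lacunary_locate rho t H) as [N HN].
{ generalize (lacunary_mono rho 0 K H); intros Hm.
  assert (rho 0%nat <= rho K) by (apply Hm; lia). lra. }
assert (K <= N)%nat.
{ destruct (Nat.le_gt_cases K N) as [h|h]; [auto|].
  assert (rho (S N) <= rho K) by (apply lacunary_mono; [auto|lia]). lra. }
exists N. split; [auto|]. apply HP; [auto|lra].
Qed.

Lemma phi_asymptotic_values rho : lacunary rho ->
  forall w : sphere, asymptotic_value (phi_of rho) w.
Proof.
intros H w. destruct gauss_sector as [c [B [Hc [HB0 HB]]]].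
assert (Hcm : Cmod c = c) by (rewrite Cmod_R, Rabs_pos_eq; lra).
assert (Hc0 : RtoC c <> 0%C) by (intros E; apply RtoC_inj in E; lra).
destruct w as [w|].
(* Each term contributes [c] times its signed weight in the limit, so the weights have to sum to
   [w / c]. *)
- destruct (signed_weight_sum (w / c)%C) as [b Hb].
  exists (fun t : R => (t * expi (angle b 0))%C).
  split; [apply ray_path_to_infty, Cmod_expi|].
  apply filterlim_locally. intros eps.
  destruct (Hb (eps / 2 / c)) as [J HJ].
  { apply Rdiv_lt_0_compat; [|auto]. generalize (cond_pos eps); lra. }
  destruct (harm_small (eps / 2 / (3 * B + 2))) as [K HK].
  { apply Rdiv_lt_0_compat; [|lra]. generalize (cond_pos eps); lra. }
  exists (rho (Nat.max J K)). intros t Ht. apply C_NormedModule_mixin_compat1.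
  change (Cmod (phi_of rho (t * expi (angle b 0)) - w)%C < eps).
  destruct (ray_eventually rho _ _ H (fun N t _ => phi_on_ray rho b c B N t H HB) t Ht)
    as [N [HN HP]].
  specialize (HJ N ltac:(lia)). specialize (HK N ltac:(lia)).
  set (p := psum (fun j => bsign (b j) * weight j)%C N) in *.
  set (f := phi_of rho (t * expi (angle b 0))%C) in *.
  replace (f - w)%C with ((f - c * p) + c * (p - w / c))%C by (field; auto).
  eapply Rle_lt_trans; [apply Cmod_triangle|]. rewrite Cmod_mult, Hcm.
  assert (H1 : c * Cmod (p - w / c)%C < eps / 2).
  { replace (eps / 2) with (c * (eps / 2 / c)) by (field; lra).
    now apply Rmult_lt_compat_l. }
  assert (H2 : (3 * B + 2) * harm N < eps / 2).
  { replace (eps / 2) with ((3 * B + 2) * (eps / 2 / (3 * B + 2))) by (field; lra).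
    apply Rmult_lt_compat_l; [lra|auto]. }
  lra.
(* All digits are 0, which gives the positive real axis: every weight has sign 1 and the real part
   of the partial sums diverges. *)
- set (b := fun _ : nat => false).
  exists (fun t : R => (t * expi (angle b 0))%C).
  split; [apply ray_path_to_infty, Cmod_expi|].
  intros P [M HM].
  destruct (weight_sum_unbounded ((M + (3 * B + 2)) / c)) as [J HJ].
  exists (rho J). intros t Ht. apply HM.
  destruct (ray_eventually rho _ _ H (fun N t _ => phi_on_ray rho b c B N t H HB) t Ht)
    as [N [HN HP]].
  specialize (HJ N HN).
  assert (E : psum (fun j => bsign (b j) * weight j)%C N = psum weight N).
  { apply psum_ext. intros j. apply Cmult_1_l. }
  rewrite E in HP. set (p := psum weight N) in *.
  set (f := phi_of rho (t * expi (angle b 0))%C) in *.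
  (* The margin [3 * B + 2] pays for the error of [phi_on_ray], since [harm N <= 1]. *)
  assert (H1 : M + (3 * B + 2) < Cmod (c * p)).
  { rewrite Cmod_mult, Hcm.
    replace (M + (3 * B + 2)) with (c * ((M + (3 * B + 2)) / c)) by (field; lra).
    now apply Rmult_lt_compat_l. }
  assert (H2 : Cmod (c * p) <= Cmod f + Cmod (f - c * p)%C).
  { rewrite <- (Cmod_opp (f - c * p)). replace (c * p)%C with (f + - (f - c * p))%C at 1 by ring.
    apply Cmod_triangle. }
  assert (H3 := harm_le_1 N). assert (H4 := harm_pos N). nra.
Qed.

Theorem theorem1 (G : R -> R)
  (Gpos : forall r, 0 <= r -> 0 < G r)
  (Gcont : forall r, 0 <= r ->
     filterlim G (within (fun s => 0 <= s) (locally r)) (locally (G r)))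
  (Ginc : forall r s, 0 <= r -> r < s -> G r < G s)
  (Glim : filterlim G (Rbar_locally p_infty) (Rbar_locally p_infty)) :
  exists (phi : C -> C) (R0 : R),
    entire phi /\ 0 < R0 /\
    (forall r, R0 < r -> ln (ln (maxmod r phi)) < G r * ln r) /\
    (forall w : sphere, asymptotic_value phi w).
Proof.
(* Divergence of [G] gives a threshold for each [j]; choosing [rho j] beyond it makes [G] exceed the
   growth exponent of the [j]-th annulus throughout that annulus. *)
destruct (functional_choice (fun j A => forall r, A < r -> 3 * INR (16 ^ j) < G r))
  as [A HA].
{ intros j. apply (Glim (fun y => 3 * INR (16 ^ j) < y)). now exists (3 * INR (16 ^ j)). }
destruct (lacunary_exists A) as [rho [Hrho HArho]].
exists (phi_of rho), (rho 0%nat). split; [|split; [|split]].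
- now apply entire_phi.
- generalize (lacunary_ge_4 rho 0 Hrho); lra.
- apply phi_growth; [auto|]. intros j r Hr. apply HA. generalize (HArho j); lra.
- now apply phi_asymptotic_values.
Qed.
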